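(* Let $F$ be an algebraically closed field, let $n\ge 2$, and let $\widehat{\mathcal A}_{n,F}$ be an affine (resp. degenerate affine) BMW algebra over $F$. Let $M$ be a simple finite dimensional $\widehat{\mathcal A}_{n,F}$-module. If $e_1M=0$, then $M$ factors through a cyclotomic (resp. degenerate cyclotomic) Hecke algebra. If $e_1M\ne0$, then $M$ factors through a cyclotomic (resp. degenerate cyclotomic) BMW algebra with admissible parameters.
   Context: **Degenerate algebras.** Let $n\ge1$, $S$ a commutative ring with $1$, $\Omega=(\omega_a)_{a\ge0}$ a sequence in $S$. The degenerate affine BMW algebra $\widehat{\mathcal N}_{n,S}(\Omega)$ is the unital associative $S$-algebra with generators $s_i,e_i$ ($1\le i<n$), $y_j$ ($1\le j\le n$) and relations (for all indices for which they make sense): (1) $s_i^2=1$; (2) $s_is_j=s_js_i$ if $|i-j|>1$, $s_is_{i+1}s_i=s_{i+1}s_is_{i+1}$, $s_iy_j=y_js_i$ if $j\ne i,i+1$; (3) $e_i^2=\omega_0e_i$; (4) $e_1y_1^ae_1=\omega_ae_1$ for $a>0$; (5) $s_ie_j=e_js_i$ and $e_ie_j=e_je_i$ if $|i-j|>1$, $e_iy_j=y_je_i$ if $j\ne i,i+1$, $y_iy_j=y_jy_i$; (6) $e_is_i=e_i=s_ie_i$, $s_ie_{i+1}e_i=s_{i+1}e_i$, $e_ie_{i+1}s_i=e_is_{i+1}$, $e_{i+1}e_is_{i+1}=e_{i+1}s_i$, $s_{i+1}e_ie_{i+1}=s_ie_{i+1}$, $e_{i+1}e_ie_{i+1}=e_{i+1}$,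 $e_ie_{i+1}e_i=e_i$; (7) $s_iy_i-y_{i+1}s_i=e_i-1$, $y_is_i-s_iy_{i+1}=e_i-1$; (8) $e_i(y_i+y_{i+1})=0=(y_i+y_{i+1})e_i$. For $r\ge1$ and $u_1,\dots,u_r\in S$, the degenerate cyclotomic BMW algebra $\mathcal N_{n,S,r}(\Omega;u_1,\dots,u_r)$ is the quotient of $\widehat{\mathcal N}_{n,S}(\Omega)$ by the relation $(y_1-u_1)\cdots(y_1-u_r)=0$. **Non-degenerate algebras.** Let $\rho,q\in S$ be invertible and $\Omega=(\omega_a)_{a\ge0}$ a sequence in $S$ with $\rho^{-1}-\rho=(q^{-1}-q)(\omega_0-1)$. The affine BMW algebra $\widehat{\mathcal W}_{n,S}(\rho,q,\Omega)$ is the unital associative $S$-algebra with generators $y_1^{\pm1}$, $g_i^{\pm1}$, $e_i$ ($1\le i\le n-1$) and relations: (1) $g_ig_i^{-1}=g_i^{-1}g_i=1$, $y_1y_1^{-1}=y_1^{-1}y_1=1$; (2) $g_ig_{i+1}g_i=g_{i+1}g_ig_{i+1}$, $g_ig_j=g_jg_i$ if $|i-j|\ge2$, $y_1g_1y_1g_1=g_1y_1g_1y_1$, $y_1g_j=g_jy_1$ if $j\ge2$; (3) $e_i^2=\omega_0e_i$; (4) $e_1y_1^je_1=\omega_je_1$ for $j\ge1$; (5) $g_ie_j=e_jg_i$ and $e_ie_j=e_je_i$ if $|i-j|\ge2$, $y_1e_j=e_jy_1$ if $j\ge2$; (6) $g_ie_i=e_ig_i=\rho^{-1}e_i$, $e_ig_{i\pm1}e_i=\rho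 e_i$, $e_ie_{i\pm1}e_i=e_i$, $g_ig_{i\pm1}e_i=e_{i\pm1}e_i$, $e_ig_{i\pm1}g_i=e_ie_{i\pm1}$; (7) $g_i-g_i^{-1}=(q-q^{-1})(1-e_i)$; (8) $e_1y_1g_1y_1g_1=e_1=g_1y_1g_1y_1e_1$. For $r\ge1$ and invertible $u_1,\dots,u_r\in S$, the cyclotomic BMW algebra $\mathcal W_{n,S,r}(\rho,q,\Omega;u_1,\dots,u_r)$ is the quotient of $\widehat{\mathcal W}_{n,S}(\rho,q,\Omega)$ by $(y_1-u_1)\cdots(y_1-u_r)=0$. $\widehat{\mathcal A}_{n,F}$ denotes $\widehat{\mathcal W}_{n,F}$ or $\widehat{\mathcal N}_{n,F}$, and $\mathcal A_{n,F,r}(u_1,\dots,u_r)$ denotes correspondingly $\mathcal W_{n,F,r}$ or $\mathcal N_{n,F,r}$ with the same parameters $\rho,q,\Omega$ (resp. $\Omega$) as $\widehat{\mathcal A}_{n,F}$. The cyclotomic (resp. degenerate cyclotomic) Hecke algebra $H_n(u_1,\dots,u_r)$ is the quotient of $\mathcal A_{n,F,r}(u_1,\dots,u_r)$ by the two-sided ideal generated by $e_1$ (equivalently, its presentation is obtained by setting all $e_i=0$). The parameters of $\mathcal A_{n,F,r}(u_1,\dots,u_r)$ are called admissible if $\{e_1,y_1e_1,\dots,y_1^{r-1}e_1\}$ is linearly independent over $F$ in $\mathcal A_{2,F,r}(u_1,\dots,u_r)$. ''$M$ factors through'' a quotient algebra means that the action of $\widehat{\mathcal A}_{n,F}$ on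 $M$ factors through the quotient map, for some $r\ge1$ and some $u_1,\dots,u_r$. *)

(* Defs.v *)
From HB Require Import structures.
From mathcomp Require Import all_boot all_algebra.
From mathcomp Require Import boolp.
From mathcomp Require Import monalg.

Set Implicit Arguments.
Unset Strict Implicit.
Unset Printing Implicit Defensive.

Import GRing.Theory.
Local Open Scope ring_scope.
Local Open Scope quotient_scope.

(** MathComp's [algType] imposes [1 != 0], but an algebra given by generators
    and relations may collapse to the zero ring.  An associative unital
    R-algebra is therefore presented as a possibly zero ring A with a ring
    morphism from R to the centre of A; [c] acts on [A] as [pzin_alg c * _]. *)
HB.mixin Record hasCentralScalars (R : pzRingType) A of GRing.PzRing A := {
  pzin_alg : R -> A;
  pzin_alg_is_zmod_morphism : zmod_morphism pzin_alg;
  pzin_alg_is_monoid_morphism : monoid_morphism pzin_alg;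
  pzin_alg_central : forall c x, pzin_alg c * x = x * pzin_alg c
}.

#[short(type="pzAlgType")]
HB.structure Definition PzAlgebra (R : pzRingType) :=
  {A of GRing.PzRing A & hasCentralScalars R A}.

Arguments pzin_alg {R A} c : rename.

HB.instance Definition _ (R : pzRingType) (A : pzAlgType R) :=
  GRing.isZmodMorphism.Build R A (@pzin_alg R A) pzin_alg_is_zmod_morphism.
HB.instance Definition _ (R : pzRingType) (A : pzAlgType R) :=
  GRing.isMonoidMorphism.Build R A (@pzin_alg R A) pzin_alg_is_monoid_morphism.

Section FreeAlgebra.
Variables (R : comNzRingType) (X : choiceType).

Definition free_alg : Type := {malg R[{fmonom X}]}.

HB.instance Definition _ := GRing.Lalgebra.on free_alg.

Definition free_const (c : R) : free_alg := malgC c.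

Fact free_alg_central (c : R) (x : free_alg) :
  free_const c * x = x * free_const c.
Proof.
rewrite [LHS]malgM_def [RHS]malgM_def fgmulUg fgmulgU.
by apply: eq_bigr => k _; rewrite mul1m mulm1 mulrC.
Qed.

Fact free_const_is_zmod_morphism : zmod_morphism free_const.
Proof. exact: rmorphB. Qed.

Fact free_const_is_monoid_morphism : monoid_morphism free_const.
Proof. by split; [exact: rmorph1 | exact: rmorphM]. Qed.

HB.instance Definition _ := hasCentralScalars.Build R free_alg
  free_const_is_zmod_morphism free_const_is_monoid_morphism free_alg_central.

Definition free_gen (x : X) : free_alg :=
  << fmu x >>.

End FreeAlgebra.

Section Quotient.
Variables (R : pzRingType) (A : pzAlgType R) (rel : A -> A -> Prop).

Inductive rel_ideal : A -> Prop :=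
| RelIdealGen x y : rel x y -> rel_ideal (x - y)
| RelIdeal0 : rel_ideal 0
| RelIdealD x y : rel_ideal x -> rel_ideal y -> rel_ideal (x + y)
| RelIdealM a x b : rel_ideal x -> rel_ideal (a * x * b).

Definition rel_ideal_pred : A -> bool := fun x => `[< rel_ideal x >].

Fact rel_ideal_zmod_closed : zmod_closed rel_ideal_pred.
Proof.
split=> [|x y /asboolP Ix /asboolP Iy]; apply/asboolP; first exact: RelIdeal0.
apply: RelIdealD => //; rewrite -[- y]mulr1 -mulN1r.
exact: RelIdealM.
Qed.

HB.instance Definition _ :=
  GRing.isZmodClosed.Build A rel_ideal_pred rel_ideal_zmod_closed.

Definition rel_zmodClosed : zmodClosed A :=
  GRing.ZmodClosed.clone A rel_ideal_pred _.

Definition quot_alg : Type := {ideal_quot rel_zmodClosed}.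

HB.instance Definition _ := GRing.Zmodule.on quot_alg.

Definition quot_pi (x : A) : quot_alg := \pi_({ideal_quot rel_zmodClosed}) x.

Lemma quot_piP x y : quot_pi x = quot_pi y <-> rel_ideal (x - y).
Proof.
split=> [/eqP|/asboolP Ixy]; rewrite /quot_pi.
  by rewrite -Quotient.idealrBE => /asboolP.
by apply/eqP; rewrite -Quotient.idealrBE.
Qed.

Definition quot_repr (x : quot_alg) : A :=
  repr (x : {ideal_quot rel_zmodClosed}).

Lemma quot_reprK : cancel quot_repr quot_pi.
Proof. by move=> x; exact: reprK. Qed.

Lemma quot_piB : zmod_morphism quot_pi.
Proof. by move=> x y; rewrite /quot_pi; exact: pi_is_zmod_morphism. Qed.

HB.instance Definition _ :=
  GRing.isZmodMorphism.Build A quot_alg quot_pi quot_piB.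

Definition quot_mul (x y : quot_alg) : quot_alg :=
  quot_pi (quot_repr x * quot_repr y).

Lemma quot_pi_mul x y : quot_pi (x * y) = quot_mul (quot_pi x) (quot_pi y).
Proof.
apply/quot_piP; set x' := quot_repr _; set y' := quot_repr _.
have Ix : rel_ideal (x - x') by apply/quot_piP; rewrite quot_reprK.
have Iy : rel_ideal (y - y') by apply/quot_piP; rewrite quot_reprK.
have -> : x * y - x' * y' = 1 * (x - x') * y + x' * (y - y') * 1.
  by rewrite mul1r mulr1 mulrBl mulrBr addrA subrK.
by apply: RelIdealD; apply: RelIdealM.
Qed.

Lemma quot_ind (P : quot_alg -> Prop) :
  (forall x, P (quot_pi x)) -> forall x, P x.
Proof. by move=> Ppi x; rewrite -(quot_reprK x). Qed.

Fact quot_mulA : associative quot_mul.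
Proof.
elim/quot_ind=> x; elim/quot_ind=> y; elim/quot_ind=> z.
by rewrite -!quot_pi_mul mulrA.
Qed.

Fact quot_mul1r : left_id (quot_pi 1) quot_mul.
Proof. by elim/quot_ind=> x; rewrite -quot_pi_mul mul1r. Qed.

Fact quot_mulr1 : right_id (quot_pi 1) quot_mul.
Proof. by elim/quot_ind=> x; rewrite -quot_pi_mul mulr1. Qed.

Fact quot_mulrDl : left_distributive quot_mul +%R.
Proof.
elim/quot_ind=> x; elim/quot_ind=> y; elim/quot_ind=> z.
by rewrite -raddfD -!quot_pi_mul mulrDl raddfD.
Qed.

Fact quot_mulrDr : right_distributive quot_mul +%R.
Proof.
elim/quot_ind=> x; elim/quot_ind=> y; elim/quot_ind=> z.
by rewrite -raddfD -!quot_pi_mul mulrDr raddfD.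
Qed.

HB.instance Definition _ := GRing.Zmodule_isPzRing.Build quot_alg
  quot_mulA quot_mul1r quot_mulr1 quot_mulrDl quot_mulrDr.

Fact quot_pi_is_monoid_morphism : monoid_morphism quot_pi.
Proof. by split=> // x y; rewrite quot_pi_mul. Qed.

HB.instance Definition _ := GRing.isMonoidMorphism.Build A quot_alg quot_pi
  quot_pi_is_monoid_morphism.

Definition quot_in_alg (c : R) : quot_alg := quot_pi (pzin_alg c).

Fact quot_in_alg_is_zmod_morphism : zmod_morphism quot_in_alg.
Proof. by move=> c d; rewrite /quot_in_alg !rmorphB. Qed.

Fact quot_in_alg_is_monoid_morphism : monoid_morphism quot_in_alg.
Proof.
by split=> [|c d]; rewrite /quot_in_alg ?rmorph1 // !rmorphM.
Qed.

Fact quot_in_alg_central c x : quot_in_alg c * x = x * quot_in_alg c.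
Proof.
by elim/quot_ind: x => x; rewrite -!rmorphM /= pzin_alg_central.
Qed.

HB.instance Definition _ := hasCentralScalars.Build R quot_alg
  quot_in_alg_is_zmod_morphism quot_in_alg_is_monoid_morphism
  quot_in_alg_central.

Lemma quot_pi_rel x y : rel x y -> quot_pi x = quot_pi y.
Proof. by move=> rxy; apply/quot_piP; apply: RelIdealGen. Qed.

End Quotient.

Arguments quot_pi {R A} rel x.

Definition simple_module (A : pzRingType) (M : lmodType A) : Prop :=
  (exists m : M, m != 0) /\
  forall S : {pred M}, submod_closed S -> (S =i pred1 0) \/ (S =i predT).

Definition finite_dimensional (R : pzRingType) (A : pzAlgType R)
    (M : lmodType A) : Prop :=
  exists (d : nat) (b : 'I_d -> M), forall m : M,
  exists c : 'I_d -> R, m = \sum_(i < d) (pzin_alg (c i) : A) *: b i.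

Definition annihilates (A : pzRingType) (a : A) (M : lmodType A) : Prop :=
  forall m : M, a *: m = 0.

Definition is_module_action (B : pzRingType) (M : zmodType)
    (act : B -> M -> M) : Prop :=
  [/\ forall m, act 1 m = m,
      forall b b' m, act (b * b') m = act b (act b' m),
      forall b b' m, act (b + b') m = act b m + act b' m
    & forall b m m', act b (m + m') = act b m + act b m'].

Definition factors_through (A B : pzRingType) (p : A -> B) (M : lmodType A) :
    Prop :=
  exists2 act : B -> M -> M, is_module_action act &
    forall (a : A) (m : M), a *: m = act (p a) m.

Definition lin_indep (R : pzRingType) (A : pzAlgType R) (r : nat)
    (v : 'I_r -> A) : Prop :=
  forall c : 'I_r -> R,
    \sum_(i < r) pzin_alg (c i) * v i = 0 -> forall i, c i = 0.

(** [idx n] is the type of indices 1, ..., n - 1. *)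
Definition idx (n : nat) := {i : nat | (0 < i < n)%N}.

Inductive dgen (n : nat) : Type :=
| DgenS of idx n
| DgenE of idx n
| DgenY of idx n.+1.

HB.instance Definition _ (n : nat) := gen_eqMixin (dgen n).
HB.instance Definition _ (n : nat) := gen_choiceMixin (dgen n).

Section Degenerate.
Variables (R : comNzRingType) (n : nat).

Local Notation FA := (free_alg R (dgen n)).

(** The generators with their usual 1-based indices.  The value 0 outside of
    the index range is a dummy: the relations below only use valid indices. *)
Definition daf_s (i : nat) : FA :=
  if insub i is Some k then free_gen R (DgenS k) else 0.
Definition daf_e (i : nat) : FA :=
  if insub i is Some k then free_gen R (DgenE k) else 0.
Definition daf_y (j : nat) : FA :=
  if insub j is Some k then free_gen R (DgenY k) else 0.

Local Notation s := daf_s.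
Local Notation e := daf_e.
Local Notation y := daf_y.
Local Notation valid i := (0 < i < n)%N.
Local Notation validY j := (0 < j <= n)%N.
Local Notation far i j := ((i.+1 < j) || (j.+1 < i))%N.

Inductive daff_rel (Omega : nat -> R) : FA -> FA -> Prop :=
| Daff_ss i : valid i -> daff_rel Omega (s i * s i) 1
| Daff_ssC i j : valid i -> valid j -> far i j ->
    daff_rel Omega (s i * s j) (s j * s i)
| Daff_braid i : valid i -> valid i.+1 ->
    daff_rel Omega (s i * s i.+1 * s i) (s i.+1 * s i * s i.+1)
| Daff_syC i j : valid i -> validY j -> j != i -> j != i.+1 ->
    daff_rel Omega (s i * y j) (y j * s i)
| Daff_ee i : valid i ->
    daff_rel Omega (e i * e i) (pzin_alg (Omega 0%N) * e i)
| Daff_eye a : (1 < n)%N -> (0 < a)%N ->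
    daff_rel Omega (e 1 * y 1 ^+ a * e 1) (pzin_alg (Omega a) * e 1)
| Daff_seC i j : valid i -> valid j -> far i j ->
    daff_rel Omega (s i * e j) (e j * s i)
| Daff_eeC i j : valid i -> valid j -> far i j ->
    daff_rel Omega (e i * e j) (e j * e i)
| Daff_eyC i j : valid i -> validY j -> j != i -> j != i.+1 ->
    daff_rel Omega (e i * y j) (y j * e i)
| Daff_yyC i j : validY i -> validY j ->
    daff_rel Omega (y i * y j) (y j * y i)
| Daff_es i : valid i -> daff_rel Omega (e i * s i) (e i)
| Daff_se i : valid i -> daff_rel Omega (s i * e i) (e i)
| Daff_seSe i : valid i -> valid i.+1 ->
    daff_rel Omega (s i * e i.+1 * e i) (s i.+1 * e i)
| Daff_eeSs i : valid i -> valid i.+1 ->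
    daff_rel Omega (e i * e i.+1 * s i) (e i * s i.+1)
| Daff_eSesS i : valid i -> valid i.+1 ->
    daff_rel Omega (e i.+1 * e i * s i.+1) (e i.+1 * s i)
| Daff_sSeeS i : valid i -> valid i.+1 ->
    daff_rel Omega (s i.+1 * e i * e i.+1) (s i * e i.+1)
| Daff_eSeeS i : valid i -> valid i.+1 ->
    daff_rel Omega (e i.+1 * e i * e i.+1) (e i.+1)
| Daff_eeSe i : valid i -> valid i.+1 ->
    daff_rel Omega (e i * e i.+1 * e i) (e i)
| Daff_sy i : valid i ->
    daff_rel Omega (s i * y i - y i.+1 * s i) (e i - 1)
| Daff_ys i : valid i ->
    daff_rel Omega (y i * s i - s i * y i.+1) (e i - 1)
| Daff_eyy i : valid i -> daff_rel Omega (e i * (y i + y i.+1)) 0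
| Daff_yye i : valid i -> daff_rel Omega ((y i + y i.+1) * e i) 0.

End Degenerate.

Definition daffBMW (R : comNzRingType) (n : nat) (Omega : nat -> R) :
  pzAlgType R := quot_alg (@daff_rel R n Omega).

Definition daff_e (R : comNzRingType) (n : nat) (Omega : nat -> R) (i : nat) :
  daffBMW n Omega := quot_pi (@daff_rel R n Omega) (daf_e R n i).
Definition daff_y (R : comNzRingType) (n : nat) (Omega : nat -> R) (j : nat) :
  daffBMW n Omega := quot_pi (@daff_rel R n Omega) (daf_y R n j).

Inductive dcyc_rel (R : comNzRingType) (n : nat) (Omega : nat -> R) (r : nat)
    (u : 'I_r -> R) : daffBMW n Omega -> daffBMW n Omega -> Prop :=
| Dcyc_rel :
    dcyc_rel u (\prod_(i < r) (daff_y n Omega 1 - pzin_alg (u i))) 0.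

Definition dcycBMW (R : comNzRingType) (n : nat) (Omega : nat -> R) (r : nat)
  (u : 'I_r -> R) : pzAlgType R := quot_alg (@dcyc_rel R n Omega r u).

Definition dcyc_pi (R : comNzRingType) (n : nat) (Omega : nat -> R) (r : nat)
  (u : 'I_r -> R) : daffBMW n Omega -> dcycBMW n Omega u :=
  quot_pi (@dcyc_rel R n Omega r u).

Inductive dhecke_rel (R : comNzRingType) (n : nat) (Omega : nat -> R) (r : nat)
    (u : 'I_r -> R) : dcycBMW n Omega u -> dcycBMW n Omega u -> Prop :=
| Dhecke_rel : dhecke_rel (dcyc_pi u (daff_e n Omega 1)) 0.

Definition dcycHecke (R : comNzRingType) (n : nat) (Omega : nat -> R)
  (r : nat) (u : 'I_r -> R) : pzAlgType R :=
  quot_alg (@dhecke_rel R n Omega r u).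

Definition dhecke_pi (R : comNzRingType) (n : nat) (Omega : nat -> R)
  (r : nat) (u : 'I_r -> R) : dcycBMW n Omega u -> dcycHecke n Omega u :=
  quot_pi (@dhecke_rel R n Omega r u).

Definition dadmissible (R : comNzRingType) (Omega : nat -> R) (r : nat)
    (u : 'I_r -> R) : Prop :=
  lin_indep (fun i : 'I_r =>
    dcyc_pi u (daff_y 2 Omega 1 ^+ i * daff_e 2 Omega 1)).

(** [AgenYV] and [AgenGV] are the generators [y_1^-1] and [g_i^-1]. *)
Inductive agen (n : nat) : Type :=
| AgenY
| AgenYV
| AgenG of idx n
| AgenGV of idx n
| AgenE of idx n.

HB.instance Definition _ (n : nat) := gen_eqMixin (agen n).
HB.instance Definition _ (n : nat) := gen_choiceMixin (agen n).

Section NonDegenerate.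
Variables (R : comUnitRingType) (n : nat).

Local Notation FA := (free_alg R (agen n)).

Definition afy : FA := free_gen R (AgenY n).
Definition afyV : FA := free_gen R (AgenYV n).
Definition afg (i : nat) : FA :=
  if insub i is Some k then free_gen R (AgenG k) else 0.
Definition afgV (i : nat) : FA :=
  if insub i is Some k then free_gen R (AgenGV k) else 0.
Definition afe (i : nat) : FA :=
  if insub i is Some k then free_gen R (AgenE k) else 0.

Local Notation y1 := afy.
Local Notation y1V := afyV.
Local Notation g := afg.
Local Notation gV := afgV.
Local Notation e := afe.
Local Notation valid i := (0 < i < n)%N.
Local Notation far i j := ((i.+1 < j) || (j.+1 < i))%N.
Local Notation adjacent i j := ((j == i.+1) || (i == j.+1)).

Inductive aff_rel (rho q : R) (Omega : nat -> R) : FA -> FA -> Prop :=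
| Aff_ggV i : valid i -> aff_rel rho q Omega (g i * gV i) 1
| Aff_gVg i : valid i -> aff_rel rho q Omega (gV i * g i) 1
| Aff_yyV : aff_rel rho q Omega (y1 * y1V) 1
| Aff_yVy : aff_rel rho q Omega (y1V * y1) 1
| Aff_braid i : valid i -> valid i.+1 ->
    aff_rel rho q Omega (g i * g i.+1 * g i) (g i.+1 * g i * g i.+1)
| Aff_ggC i j : valid i -> valid j -> far i j ->
    aff_rel rho q Omega (g i * g j) (g j * g i)
| Aff_ygyg : (1 < n)%N ->
    aff_rel rho q Omega (y1 * g 1 * y1 * g 1) (g 1 * y1 * g 1 * y1)
| Aff_ygC j : valid j -> (2 <= j)%N ->
    aff_rel rho q Omega (y1 * g j) (g j * y1)
| Aff_ee i : valid i ->
    aff_rel rho q Omega (e i * e i) (pzin_alg (Omega 0%N) * e i)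
| Aff_eye a : (1 < n)%N -> (0 < a)%N ->
    aff_rel rho q Omega (e 1 * y1 ^+ a * e 1) (pzin_alg (Omega a) * e 1)
| Aff_geC i j : valid i -> valid j -> far i j ->
    aff_rel rho q Omega (g i * e j) (e j * g i)
| Aff_eeC i j : valid i -> valid j -> far i j ->
    aff_rel rho q Omega (e i * e j) (e j * e i)
| Aff_yeC j : valid j -> (2 <= j)%N ->
    aff_rel rho q Omega (y1 * e j) (e j * y1)
| Aff_ge i : valid i ->
    aff_rel rho q Omega (g i * e i) (pzin_alg rho^-1 * e i)
| Aff_eg i : valid i ->
    aff_rel rho q Omega (e i * g i) (pzin_alg rho^-1 * e i)
| Aff_ege i j : valid i -> valid j -> adjacent i j ->
    aff_rel rho q Omega (e i * g j * e i) (pzin_alg rho * e i)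
| Aff_eee i j : valid i -> valid j -> adjacent i j ->
    aff_rel rho q Omega (e i * e j * e i) (e i)
| Aff_gge i j : valid i -> valid j -> adjacent i j ->
    aff_rel rho q Omega (g i * g j * e i) (e j * e i)
| Aff_egg i j : valid i -> valid j -> adjacent i j ->
    aff_rel rho q Omega (e i * g j * g i) (e i * e j)
| Aff_skein i : valid i ->
    aff_rel rho q Omega (g i - gV i) (pzin_alg (q - q^-1) * (1 - e i))
| Aff_eygyg : (1 < n)%N ->
    aff_rel rho q Omega (e 1 * y1 * g 1 * y1 * g 1) (e 1)
| Aff_gygye : (1 < n)%N ->
    aff_rel rho q Omega (g 1 * y1 * g 1 * y1 * e 1) (e 1).

End NonDegenerate.

(** [rho] and [q] are meant to be invertible. *)
Definition affBMW (R : comUnitRingType) (n : nat) (rho q : R)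
  (Omega : nat -> R) : pzAlgType R := quot_alg (@aff_rel R n rho q Omega).

Definition aff_e (R : comUnitRingType) (n : nat) (rho q : R)
  (Omega : nat -> R) (i : nat) : affBMW n rho q Omega :=
  quot_pi (@aff_rel R n rho q Omega) (afe R n i).
Definition aff_y1 (R : comUnitRingType) (n : nat) (rho q : R)
  (Omega : nat -> R) : affBMW n rho q Omega :=
  quot_pi (@aff_rel R n rho q Omega) (afy R n).

Inductive cyc_rel (R : comUnitRingType) (n : nat) (rho q : R)
    (Omega : nat -> R) (r : nat) (u : 'I_r -> R) :
    affBMW n rho q Omega -> affBMW n rho q Omega -> Prop :=
| Cyc_rel :
    cyc_rel u (\prod_(i < r) (aff_y1 n rho q Omega - pzin_alg (u i))) 0.

Definition cycBMW (R : comUnitRingType) (n : nat) (rho q : R)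
  (Omega : nat -> R) (r : nat) (u : 'I_r -> R) : pzAlgType R :=
  quot_alg (@cyc_rel R n rho q Omega r u).

Definition cyc_pi (R : comUnitRingType) (n : nat) (rho q : R)
  (Omega : nat -> R) (r : nat) (u : 'I_r -> R) :
  affBMW n rho q Omega -> cycBMW n rho q Omega u :=
  quot_pi (@cyc_rel R n rho q Omega r u).

Inductive hecke_rel (R : comUnitRingType) (n : nat) (rho q : R)
    (Omega : nat -> R) (r : nat) (u : 'I_r -> R) :
    cycBMW n rho q Omega u -> cycBMW n rho q Omega u -> Prop :=
| Hecke_rel : hecke_rel (cyc_pi u (aff_e n rho q Omega 1)) 0.

Definition cycHecke (R : comUnitRingType) (n : nat) (rho q : R)
  (Omega : nat -> R) (r : nat) (u : 'I_r -> R) : pzAlgType R :=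
  quot_alg (@hecke_rel R n rho q Omega r u).

Definition hecke_pi (R : comUnitRingType) (n : nat) (rho q : R)
  (Omega : nat -> R) (r : nat) (u : 'I_r -> R) :
  cycBMW n rho q Omega u -> cycHecke n rho q Omega u :=
  quot_pi (@hecke_rel R n rho q Omega r u).

Definition admissible (R : comUnitRingType) (rho q : R) (Omega : nat -> R)
    (r : nat) (u : 'I_r -> R) : Prop :=
  lin_indep (fun i : 'I_r =>
    cyc_pi u (aff_y1 2 rho q Omega ^+ i * aff_e 2 rho q Omega 1)).

(* Main.v *)
Require Import Defs.
From HB Require Import structures.
From mathcomp Require Import all_boot all_algebra.
From mathcomp Require Import boolp monalg zify.

Set Implicit Arguments.
Unset Strict Implicit.
Unset Printing Implicit Defensive.

Import GRing.Theory.
Local Open Scope ring_scope.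

(** Let [y] be the generator [y_1], acting on the simple module [M].

    If [e_1 M = 0], the minimal polynomial of [y] on [M] splits over [F], and
    its roots [u_i] give a cyclotomic quotient through which [M] factors; as
    [e_1] acts by zero, [M] also factors through the Hecke quotient.

    If [e_1 M <> 0], let [p] be the monic polynomial of least degree with
    [p(y) e_1 M = 0]; it will turn out to be the minimal polynomial of [y]. By
    minimality no nonzero polynomial of smaller degree kills [e_1 M], so
    [e_1, y e_1, ..., y^(r-1) e_1] are independent as operators on [M], where
    [r] is the degree of [p]. Since the subalgebra generated by the generators on the
    first two strands is an image of the algebra with [n = 2], a dependence in
    the cyclotomic algebra with [n = 2] would act on [M] and contradict this:
    the roots of [p] are admissible parameters. It remains to see that [M]
    itself factors through this cyclotomic quotient, that is, [p(y) M = 0]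
    ([aff_killing_extends], [daff_killing_extends]).

    Write [x = p(y)], which commutes with [g_j] and [e_j] for [j >= 2].  A
    vector [m] is called stably killed when [x] kills [g_1 ... g_k m] for all
    [k < n].  These words represent the cosets of the parabolic generated by
    the [g_j] with [j >= 2], so the stably killed vectors ought to form a
    submodule.  They do, because the error terms produced by the skein
    relation and by moving [y] past [g_i] either are shorter descents or
    contain some [g_1 ... g_k e_j], and [x] kills the latter:
    [x g_1 ... g_k e_j M = 0] follows from [x e_1 M = 0] by sliding
    the word through [e_j] ([killed_descent_e]).  The same fact
    shows that [e_1 M], which is not zero, consists of stably killed vectors.
    As [M] is simple every vector is stably killed, and [k = 0] gives
    [x M = 0].

    For the [g_j] and [e_j] the argument rests on the relations collected in
    [kauffman_relations].  They hold for [g_i] with parameter [q - q^-1] and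
    for [s_i] with parameter [0], so both families are treated together; the
    generators [y_j] are treated apart. *)

(** * Free algebras *)

Lemma free_alg_ind (R : comNzRingType) (X : choiceType)
    (P : free_alg R X -> Prop) :
  (forall c, P (pzin_alg c)) -> (forall x, P (free_gen R x)) ->
  (forall a b, P a -> P b -> P (a + b)) ->
  (forall a b, P a -> P b -> P (a * b)) -> forall a, P a.
Proof.
move=> PC PX PD PM a; rewrite (monalgE (a : {malg R[{fmonom X}]})).
elim/big_ind: _ => [|b c|k _]; [|exact: PD|].
  by have := PC 0; rewrite rmorph0.
have -> : << a@_k *g k >> = malgC a@_k * << k >> :> {malg R[{fmonom X}]}.
  by rewrite malgM_def fgmulUU mulr1 mul1m.
apply: (PM); first exact: PC.
case: k => s; elim: s => [|x s IHs].
  rewrite -fmoneE.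
  by have := PC 1; rewrite rmorph1.
have -> : << FMonom (x :: s) >> =
    free_gen R x * << FMonom s >> :> {malg R[{fmonom X}]}.
  rewrite malgM_def fgmulUU mulr1; congr (<< _ *g _ >>).
  by apply/eqP; rewrite fmP fmM fmU.
exact: PM.
Qed.

Section Relabel.
Variables (R : comNzRingType) (X Y : choiceType) (f : X -> Y).

Definition relabel_monom (m : {fmonom X}) : {malg R[{fmonom Y}]} :=
  \prod_(x <- m) free_gen R (f x).

Fact relabel_monom_is_mmorphism : mmorphism relabel_monom.
Proof.
rewrite /relabel_monom; split=> [m m'|]; first by rewrite fmM big_cat.
by rewrite fm1 big_nil.
Qed.

HB.instance Definition _ := isMultiplicative.Build _ _ relabel_monom
  relabel_monom_is_mmorphism.

Definition relabel : free_alg R X -> free_alg R Y :=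
  mmap (@malgC {fmonom Y} R) relabel_monom.

Fact relabel_is_zmod_morphism : zmod_morphism relabel.
Proof. exact: mmapB. Qed.

Fact relabel_is_monoid_morphism : monoid_morphism relabel.
Proof.
have [] := @commr_mmap_is_multiplicative _ _ _ (@malgC {fmonom Y} R)
  relabel_monom; last by move=> relabelM relabel1; split.
by move=> g m m'; exact: (@free_alg_central R Y).
Qed.

HB.instance Definition _ := GRing.isZmodMorphism.Build _ _ relabel
  relabel_is_zmod_morphism.
HB.instance Definition _ := GRing.isMonoidMorphism.Build _ _ relabel
  relabel_is_monoid_morphism.

Lemma relabelC c : relabel (pzin_alg c) = pzin_alg c.
Proof. exact: mmapC. Qed.

Lemma relabel_gen x : relabel (free_gen R x) = free_gen R (f x).
Proof.
rewrite /relabel /free_gen mmapU /relabel_monom fmU big_seq1.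
exact: mul1r.
Qed.

End Relabel.

(** * Actions of quotient algebras *)

Lemma module_action0 (A : pzRingType) (M : zmodType) (act : A -> M -> M) m :
  is_module_action act -> act 0 m = 0.
Proof.
by move=> [_ _ actD _]; apply: (addIr (act 0 m)); rewrite -actD !add0r.
Qed.

(** The defining relations generate the kernel of the quotient map, hence an
    action that respects them depends only on the class modulo the ideal. *)
Lemma descend_action (R : pzRingType) (A : pzAlgType R)
    (rel : A -> A -> Prop) (M : zmodType) (act : A -> M -> M) :
  is_module_action act ->
  (forall a b, rel a b -> forall m, act a m = act b m) ->
  exists2 act' : quot_alg rel -> M -> M, is_module_action act' &
    forall a m, act' (quot_pi rel a) m = act a m.
Proof.
move=> actP actrel; have [act1 actM actD actDr] := actP.
have act0r a : act a 0 = 0.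
  by apply: (addIr (act a 0)); rewrite -actDr !add0r.
have actB a b m : act (a - b) m = act a m - act b m.
  by apply/(canRL (addrK _)); rewrite -actD subrK.
have act_ideal a : rel_ideal rel a -> forall m, act a m = 0.
  elim=> [b c /actrel bc m|m|b c _ b0 _ c0 m|b c d _ c0 m].
  - by rewrite actB bc subrr.
  - exact: module_action0.
  - by rewrite actD b0 c0 addr0.
  - by rewrite !actM c0 act0r.
have act_pi a m : act (quot_repr (quot_pi rel a)) m = act a m.
  apply/eqP; rewrite -subr_eq0 -actB act_ideal //.
  by apply/quot_piP; rewrite quot_reprK.
exists (fun a => act (quot_repr a)) => //; split.
- by move=> m; rewrite -(rmorph1 (quot_pi rel)) act_pi.
- elim/quot_ind=> a; elim/quot_ind=> b m.
  by rewrite -rmorphM !act_pi.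
- elim/quot_ind=> a; elim/quot_ind=> b m.
  by rewrite -rmorphD !act_pi.
- by move=> a m m'.
Qed.

Lemma scale_is_module_action (A : pzRingType) (M : lmodType A) :
  is_module_action (fun (a : A) (m : M) => a *: m).
Proof.
split=> *; [exact: scale1r | by rewrite scalerA | exact: scalerDl
  | exact: scalerDr].
Qed.

(** * Minimal polynomials

    [ev p] stands for the value of the polynomial [p] at the element
    [ev 'X] of [A]. *)

Section MinimalAnnihilator.
Variables (F : closedFieldType) (A : pzAlgType F) (M : lmodType A).
Variables (ev : {rmorphism {poly F} -> A}).
Hypothesis evC : forall c, ev c%:P = pzin_alg c.

(** Cayley-Hamilton: the matrix [Y] describes [ev 'X] on a spanning family
    that may well be dependent, yet the characteristic polynomial of [Y] still
    kills every member of the family, and scalars are central. *)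
Lemma exists_annihilating_poly :
  finite_dimensional M -> exists2 p : {poly F}, p != 0 & annihilates (ev p) M.
Proof.
move=> [d [b bM]].
case: d b bM => [b bM|d b bM].
  exists 1; first exact: oner_neq0.
  by move=> m; have [c ->] := bM m; rewrite big_ord0 scaler0.
have [Y bY] : exists Y : 'M[F]_d.+1,
    forall i, ev 'X *: b i = \sum_j (pzin_alg (Y i j) : A) *: b j.
  pose c i := projT1 (cid (bM (ev 'X *: b i))).
  exists (\matrix_(i, j) c i j) => i.
  rewrite {1}(projT2 (cid (bM (ev 'X *: b i)))).
  by apply: eq_bigr => j _; rewrite mxE.
have pY (p : {poly F}) i : ev p *: b i =
    \sum_j (pzin_alg (horner_mx Y p i j) : A) *: b j.
  elim/poly_ind: p i => [i|p a IHp i].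
    rewrite !rmorph0 scale0r big1 // => j _.
    by rewrite mxE rmorph0 scale0r.
  rewrite rmorphD rmorphM evC scalerDl -scalerA bY scaler_sumr.
  under eq_bigr => j _.
    rewrite scalerA -pzin_alg_central -scalerA IHp scaler_sumr.
    under eq_bigr => k _ do rewrite scalerA -rmorphM.
    over.
  rewrite exchange_big /=.
  have -> : (pzin_alg a : A) *: b i =
      \sum_j (pzin_alg (a *+ (i == j)) : A) *: b j.
    rewrite (bigD1 i) //= eqxx mulr1n big1 ?addr0 // => j.
    by rewrite eq_sym => /negPf->; rewrite mulr0n rmorph0 scale0r.
  rewrite -big_split /=; apply: eq_bigr => k _.
  rewrite -scaler_suml -scalerDl -rmorph_sum -rmorphD; congr (pzin_alg _ *: _).
  rewrite rmorphD rmorphM /= horner_mx_X horner_mx_C.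
  rewrite -[horner_mx Y p * Y]/(horner_mx Y p *m Y).
  have -> : horner_mx Y p *m Y = Y *m horner_mx Y p.
    exact: (comm_horner_mx p (erefl (Y *m Y))).
  by rewrite !mxE.
exists (char_poly Y); first by rewrite monic_neq0 ?char_poly_monic.
move=> m; have [c ->] := bM m.
rewrite scaler_sumr big1 // => i _.
rewrite scalerA -pzin_alg_central -scalerA pY Cayley_Hamilton.
by rewrite big1 ?scaler0 // => j _; rewrite mxE rmorph0 scale0r.
Qed.

Variable e : A.
Hypotheses (fdM : finite_dimensional M) (eM : ~ annihilates e M).

Lemma exists_minimal_poly :
  exists2 p : {poly F}, p != 0 /\ annihilates (ev p * e) M &
    forall q, annihilates (ev q * e) M -> (size q < size p)%N -> q = 0.
Proof.
have [p0 p0n p0M] := exists_annihilating_poly fdM.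
pose good n := `[< exists2 p : {poly F}, p != 0 /\ annihilates (ev p * e) M &
  size p = n >].
have ex_good : exists n, good n.
  exists (size p0); apply/asboolP; exists p0; split=> // m.
  by rewrite -scalerA p0M.
case: (ex_minnP ex_good) => n /asboolP[p [pn pM] <-] p_min; exists p => // q qM.
apply: contraPeq => qn; apply/negP; rewrite -leqNgt; apply: p_min.
by apply/asboolP; exists q.
Qed.

(** The [u i] are the roots of a polynomial [p] of least degree with
    [p(y) e M = 0], for [y = ev 'X].  If zero were a root and [y] injective, a
    factor [y] could be cancelled against minimality; and a relation between
    [e, y e, ..., y^(r-1) e] on [M] is a polynomial of degree below that of
    [p], hence zero. *)
Lemma exists_minimal_factors :
  exists (r : nat) (u : 'I_r -> F),
    [/\ (1 <= r)%N,
        annihilates (\prod_(i < r) (ev 'X - pzin_alg (u i)) * e) M,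
        (forall m : M, ev 'X *: m = 0 -> m = 0) -> forall i, u i != 0 &
        forall c : 'I_r -> F,
          annihilates (\sum_(i < r) pzin_alg (c i) * (ev 'X ^+ i * e)) M ->
          forall i, c i = 0].
Proof.
have [p [pn pM] p_min] := exists_minimal_poly.
have [rs pE] := closed_field_poly_normal p.
have lc_n : lead_coef p != 0 by rewrite lead_coef_eq0.
pose P := \prod_(z <- rs) ('X - z%:P).
have size_p : size p = (size rs).+1.
  by rewrite pE size_scale // size_prod_XsubC.
have PM : annihilates (ev P * e) M.
  move=> m; have := pM m; rewrite pE -mul_polyC rmorphM evC -/P.
  move=> /(congr1 (fun m => (pzin_alg (lead_coef p)^-1 : A) *: m)).
  by rewrite scaler0 scalerA !mulrA -rmorphM mulVf // rmorph1 mul1r.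
exists (size rs), (tnth (in_tuple rs)).
have factorsE : \prod_(i < size rs) (ev 'X - pzin_alg (tnth (in_tuple rs) i)) =
    ev P.
  rewrite rmorph_prod (big_tnth _ _ rs) /=.
  by apply: eq_bigr => i _; rewrite rmorphB evC.
split.
- rewrite lt0n; apply/eqP => /size0nil rs0; apply: eM => m.
  by have := PM m; rewrite /P rs0 big_nil rmorph1 mul1r.
- by rewrite factorsE.
- move=> inj_y i; apply/eqP => u0.
  have rs_0 : 0 \in rs by rewrite -u0 mem_tnth.
  pose Q := \prod_(z <- rem 0 rs) ('X - z%:P).
  have QM : annihilates (ev Q * e) M.
    move=> m; apply: inj_y; rewrite scalerA mulrA -rmorphM.
    have := PM m; rewrite /P (big_rem 0 rs_0) /= polyC0 subr0.
    by [].
  have Q0 : Q = 0.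
    apply: p_min QM _; rewrite size_p size_prod_XsubC size_rem // prednK //.
    by rewrite -has_predT; apply/hasP; exists 0.
  by have := monic_neq0 (monic_prod_XsubC (rem 0 rs) xpredT id);
    rewrite -/Q Q0 eqxx.
- move=> c cM i.
  pose q : {poly F} := \sum_(j < size rs) (c j)%:P * 'X^j.
  have qE : q = \poly_(j < size rs) (if insub j is Some k then c k else 0).
    rewrite poly_def; apply: eq_bigr => j _.
    by rewrite valK mul_polyC.
  have q0 : q = 0.
    apply: p_min; last by rewrite size_p ltnS qE size_poly.
    move=> m; rewrite -[RHS](cM m); congr (_ *: m).
    rewrite rmorph_sum mulr_suml; apply: eq_bigr => j _.
    by rewrite rmorphM rmorphXn evC mulrA.
  have := congr1 (fun p : {poly F} => p`_i) q0.
  by rewrite qE coef_poly ltn_ord valK coef0.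
Qed.

End MinimalAnnihilator.

Lemma action_prod_sub (F : pzRingType) (A B : pzAlgType F) (M : lmodType A)
    (act : B -> M -> M) (y : A) (yB : B) (r : nat) (u : 'I_r -> F) (m : M) :
  is_module_action act ->
  (forall c m, act (pzin_alg c) m = (pzin_alg c : A) *: m) ->
  (forall m, act yB m = y *: m) ->
  act (\prod_(i < r) (yB - pzin_alg (u i))) m =
    \prod_(i < r) (y - pzin_alg (u i)) *: m.
Proof.
move=> [act1 actM actD _] actC acty.
elim/big_rec2: _ m => [m|i a b _ IH m]; first by rewrite act1 scale1r.
rewrite actM -scalerA -IH -rmorphN actD acty actC -scalerDl.
by rewrite rmorphN.
Qed.

(** If [B / rel] also acts on [M] through [B], with [yB] and [eB] acting like
    [y] and [e], then a dependence in [B / rel] is seen on [M]. *)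
Lemma cyclotomic_lin_indep (F : pzRingType) (A B : pzAlgType F)
    (rel : B -> B -> Prop) (M : lmodType A) (act : B -> M -> M)
    (y e : A) (yB eB : B) (r : nat) :
  is_module_action act ->
  (forall c m, act (pzin_alg c) m = (pzin_alg c : A) *: m) ->
  (forall m, act yB m = y *: m) -> (forall m, act eB m = e *: m) ->
  (forall a b, rel a b -> forall m, act a m = act b m) ->
  (forall c : 'I_r -> F,
     annihilates (\sum_(i < r) pzin_alg (c i) * (y ^+ i * e)) M ->
     forall i, c i = 0) ->
  lin_indep (fun i : 'I_r => quot_pi rel (yB ^+ i * eB)).
Proof.
move=> actP actC acty acte actrel indep c sum0; apply: indep => m.
have [act' act'P act'E] := descend_action actP actrel.
have [act1 actM actD actDr] := actP.
have actX i m' : act (yB ^+ i) m' = y ^+ i *: m'.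
  elim: i m' => [|i IHi] m'; first by rewrite act1 scale1r.
  by rewrite !exprS actM IHi acty scalerA.
have sumE : act (\sum_(i < r) pzin_alg (c i) * (yB ^+ i * eB)) m =
    (\sum_(i < r) pzin_alg (c i) * (y ^+ i * e)) *: m.
  elim/big_rec2: _ => [|i a b _ IH].
    by rewrite (module_action0 _ actP) scale0r.
  by rewrite actD IH !actM actC actX acte scalerDl !scalerA mulrA.
rewrite -sumE -act'E rmorph_sum.
under eq_bigr do rewrite rmorphM.
by rewrite sum0 (module_action0 _ act'P).
Qed.

(** * Modules over presented algebras *)

Section FreePresentation.
Variables (F : comNzRingType) (X : choiceType) (B : pzAlgType F).
Variable phi : {rmorphism free_alg F X -> B}.
Hypothesis phiC : forall c, phi (pzin_alg c) = pzin_alg c.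

Lemma exists_poly_eval (a : free_alg F X) :
  exists2 ev : {rmorphism {poly F} -> B},
    forall c, ev c%:P = pzin_alg c & ev 'X = phi a.
Proof.
have comm_a : commr_rmorph (@malgC {fmonom X} F) a.
  by move=> c; apply/esym; exact: (@free_alg_central F X).
(* In the free algebra, which is not the zero ring, polynomials can be
   evaluated by the Horner scheme; [phi] carries the value to [B]. *)
pose ev := phi \o (horner_morph comm_a : {poly F} -> free_alg F X).
have evB : zmod_morphism ev by move=> p q; rewrite /ev /= !rmorphB.
have evM : monoid_morphism ev.
  by split=> [|p q]; rewrite /ev /= ?rmorph1 // !rmorphM.
pose evZ := GRing.isZmodMorphism.Build _ _ ev evB.
pose evR := GRing.isMonoidMorphism.Build _ _ ev evM.
exists (HB.pack_for {rmorphism {poly F} -> B} ev evZ evR) => [c|] /=.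
  by rewrite /ev /= horner_morphC -phiC.
by rewrite /ev /= horner_morphX.
Qed.

Lemma simple_module_ind (M : lmodType B) (S : M -> Prop) :
  (forall b, exists a, b = phi a) -> simple_module M ->
  S 0 -> (forall m m', S m -> S m' -> S (m + m')) ->
  (forall c m, S m -> S ((pzin_alg c : B) *: m)) ->
  (forall x m, S m -> S (phi (free_gen F x) *: m)) ->
  (exists2 m, m != 0 & S m) -> forall m, S m.
Proof.
move=> phi_surj [_ simpleM] S0 SD SC SX [m0 m0n Sm0] m.
have SA b m' : S m' -> S (b *: m').
  have [a ->] := phi_surj b.
  elim/free_alg_ind: a m' => [c|x|a a' IHa IHa'|a a' IHa IHa'] m' Sm'.
  - by rewrite phiC; exact: SC.
  - exact: SX.
  - by rewrite rmorphD scalerDl; apply: SD; [exact: IHa | exact: IHa'].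
  - by rewrite rmorphM -scalerA; apply: IHa; exact: IHa'.
pose S_pred : {pred M} := fun m => `[< S m >].
have S_closed : submod_closed S_pred.
  split=> [|a m1 m2 /asboolP Sm1 /asboolP Sm2]; apply/asboolP => //.
  by apply: SD => //; exact: SA.
have [S_0|S_T] := simpleM _ S_closed.
  have : m0 \in S_pred by apply/asboolP.
  by rewrite S_0 inE (negPf m0n).
by apply/asboolP; have := S_T m; rewrite inE.
Qed.

End FreePresentation.

(** * Vectors killed after every descent

    Here [descent k] is the word [g_1 ... g_k], with [descent 0 = 1]. *)

Lemma comm_inverse (A : pzRingType) (a b b' : A) :
  b * b' = 1 -> b' * b = 1 -> GRing.comm a b -> GRing.comm a b'.
Proof.
move=> bb' b'b ab; rewrite /GRing.comm -[LHS]mul1r -b'b.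
by rewrite mulrA -[b' * b * a]mulrA -ab -!mulrA bb' mulr1.
Qed.

Section Kauffman.
Variables (F : comNzRingType) (A : pzAlgType F) (n : nat).

Local Notation valid i := (0 < i < n)%N.
Local Notation far i j := ((i.+1 < j) || (j.+1 < i))%N.

(** [z] is the parameter of the skein relation, [q - q^-1] or [0], and [c] the
    twist, [rho^-1] or [1]. *)
Record kauffman_relations (z c : F) (g gV e : nat -> A) : Prop := {
  kauffman_gVg i : valid i -> gV i * g i = 1;
  kauffman_skein i : valid i -> g i - gV i = pzin_alg z * (1 - e i);
  kauffman_ge i : valid i -> g i * e i = pzin_alg c * e i;
  kauffman_ggC i j : valid i -> valid j -> far i j -> g i * g j = g j * g i;
  kauffman_geC i j : valid i -> valid j -> far i j -> g i * e j = e j * g i;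
  kauffman_braid i : valid i -> valid i.+1 ->
    g i * g i.+1 * g i = g i.+1 * g i * g i.+1;
  kauffman_ggSe i : valid i -> valid i.+1 -> g i * g i.+1 * e i = e i.+1 * e i;
  kauffman_gSgeS i : valid i -> valid i.+1 ->
    g i.+1 * g i * e i.+1 = e i * e i.+1;
  kauffman_eSggS i : valid i -> valid i.+1 ->
    e i.+1 * g i * g i.+1 = e i.+1 * e i;
  kauffman_eSeeS i : valid i -> valid i.+1 -> e i.+1 * e i * e i.+1 = e i.+1
}.

Variables (z c : F) (g gV e : nat -> A).
Hypothesis K : kauffman_relations z c g gV e.

Lemma kauffman_gVE i : valid i -> gV i = g i - pzin_alg z * (1 - e i).
Proof. by move=> i_n; rewrite -(kauffman_skein K) // subKr. Qed.

Lemma kauffman_gE i : valid i -> g i = gV i + pzin_alg z * (1 - e i).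
Proof. by move=> i_n; rewrite -(kauffman_skein K) // addrC subrK. Qed.

Definition descent (k : nat) : A := \prod_(1 <= i < k.+1) g i.

Lemma descent0 : descent 0 = 1.
Proof. by rewrite /descent big_geq. Qed.

Lemma descentS k : descent k.+1 = descent k * g k.+1.
Proof. by rewrite /descent big_nat_recr. Qed.

Lemma descent_comm k a :
  (forall i, (0 < i <= k)%N -> GRing.comm a (g i)) -> GRing.comm a (descent k).
Proof.
elim: k => [|k IHk] a_g; first by rewrite descent0; exact: commr1.
rewrite descentS; apply: commrM; last by apply: a_g; rewrite /= leqnn.
by apply: IHk => i /andP[i0 ik]; apply: a_g; rewrite i0 leqW.
Qed.

Lemma descent_g_far j k : (k.+1 < j < n)%N -> g j * descent k = descent k * g j.
Proof.
by move=> jk; apply: descent_comm => i ik; apply: (kauffman_ggC K); lia.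
Qed.

Lemma descent_e_far j k : (k.+1 < j < n)%N -> e j * descent k = descent k * e j.
Proof.
move=> jk; apply: descent_comm => i ik; apply/esym.
by apply: (kauffman_geC K); lia.
Qed.

Lemma descent_gV_far j k :
  (k.+1 < j < n)%N -> gV j * descent k = descent k * gV j.
Proof.
move=> jk; rewrite kauffman_gVE; last by lia.
apply/esym; apply: commrB; first exact/esym/descent_g_far.
apply: commrM; first exact/esym/pzin_alg_central.
by apply: commrB; [exact: commr1 | exact/esym/descent_e_far].
Qed.

(** The braid relation [g_j g_(j+1) g_j = g_(j+1) g_j g_(j+1)] moves [g_j]
    through the two letters [g_j g_(j+1)] of the word and raises its index by
    one.  It commutes with the letters after these, and [g_(j+1)] with those
    before. *)
Lemma descent_g_shift j k :
  (0 < j < k)%N -> (k < n)%N -> descent k * g j = g j.+1 * descent k.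
Proof.
elim: k => [|k IHk]; first by lia.
move=> jk kn; have [jltk|] := ltnP j k.
  rewrite descentS -mulrA (kauffman_ggC K); try by lia.
  by rewrite mulrA IHk ?mulrA //; lia.
move=> {IHk} kj; have -> : k = j by lia.
case: j jk kj => [|j] // jk kj; rewrite !descentS.
have jn : valid j.+1 by lia.
have jSn : valid j.+2 by lia.
rewrite -!mulrA [g j.+1 * (_ * _)]mulrA (kauffman_braid K) //.
by rewrite [RHS]mulrA descent_g_far ?mulrA //; lia.
Qed.

(** As for [g_j], since
    [g_j g_(j+1) e_j = e_(j+1) e_j = e_(j+1) g_j g_(j+1)]. *)
Lemma descent_e_shift j k :
  (0 < j < k)%N -> (k < n)%N -> descent k * e j = e j.+1 * descent k.
Proof.
elim: k => [|k IHk]; first by lia.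
move=> jk kn; have [jltk|] := ltnP j k.
  rewrite descentS -mulrA (kauffman_geC K); try by lia.
  by rewrite mulrA IHk ?mulrA //; lia.
move=> {IHk} kj; have -> : k = j by lia.
case: j jk kj => [|j] // jk kj; rewrite !descentS.
have jn : valid j.+1 by lia.
have jSn : valid j.+2 by lia.
rewrite -!mulrA [g j.+1 * (_ * _)]mulrA (kauffman_ggSe K) //.
rewrite -(kauffman_eSggS K) // [in RHS]mulrA descent_e_far ?mulrA //; lia.
Qed.

Section Stable.
Variables (M : lmodType A) (x : A).
Hypothesis x_g : forall j, (1 < j < n)%N -> GRing.comm x (g j).
Hypothesis x_e : forall j, (1 < j < n)%N -> GRing.comm x (e j).
Hypothesis xe1 : annihilates (x * e 1) M.

Definition killed (m : M) : Prop := x *: m = 0.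

Lemma killedD m m' : killed m -> killed m' -> killed (m + m').
Proof. by rewrite /killed scalerDr => -> ->; rewrite addr0. Qed.

Lemma killedB m m' : killed m -> killed m' -> killed (m - m').
Proof. by rewrite /killed scalerBr => -> ->; rewrite subr0. Qed.

Lemma killed_comm a m : GRing.comm x a -> killed m -> killed (a *: m).
Proof.
by rewrite /killed => xa xm; rewrite scalerA xa -scalerA xm scaler0.
Qed.

Lemma killed_scalar b m : killed m -> killed ((pzin_alg b : A) *: m).
Proof. by apply: killed_comm; apply/esym; exact: pzin_alg_central. Qed.

Lemma comm_gV j : (1 < j < n)%N -> GRing.comm x (gV j).
Proof.
move=> jn; rewrite kauffman_gVE; last by lia.
apply: commrB; first exact: x_g.
apply: commrM; first by apply/esym; exact: pzin_alg_central.
by apply: commrB; [exact: commr1 | exact: x_e].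
Qed.

(** [e_(j+1) = e_(j+1) e_j e_(j+1)], and [e_(j+1)] commutes with [x]: the case
    of [e_1] propagates to all [e_j]. *)
Lemma killed_e j m : valid j -> killed (e j *: m).
Proof.
elim: j m => [|j IHj] m //; case: j IHj => [|j] IHj jn.
  by rewrite /killed scalerA xe1.
rewrite -(kauffman_eSeeS K); [|lia..].
rewrite -2!scalerA; apply: killed_comm; first by apply: x_e; lia.
by apply: IHj; lia.
Qed.

(** The crucial case, where the last letter of the word meets [e_(k+1)].  From
    [g_k e_(k+1) = g_(k+1)^-1 e_k e_(k+1)] that letter is traded for a factor
    [g_(k+1)^-1] which commutes with the rest of the word and with [x], leaving
    the same situation one step lower. *)
Lemma killed_descent_eS k m : (k.+1 < n)%N ->
  killed (descent k *: (e k.+1 *: m)).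
Proof.
elim: k m => [|k IHk] m kn; first by rewrite descent0 scale1r; exact: killed_e.
have kn1 : valid k.+1 by lia.
have kn2 : valid k.+2 by lia.
have geE : g k.+1 * e k.+2 = gV k.+2 * e k.+1 * e k.+2.
  by rewrite -mulrA -(kauffman_gSgeS K) // !mulrA (kauffman_gVg K) // mul1r.
have -> : descent k.+1 *: (e k.+2 *: m) =
    gV k.+2 *: (descent k *: (e k.+1 *: (e k.+2 *: m))).
  rewrite !scalerA descentS -mulrA geE !mulrA descent_gV_far //; lia.
by apply: killed_comm; [apply: comm_gV; lia | apply: IHk; lia].
Qed.

(** Depending on [j], the factor [e_j] passes the word with index [j + 1], is
    absorbed by its last letter up to the twist, meets it as in
    [killed_descent_eS], or commutes with it. *)
Lemma killed_descent_e k j m : (k < n)%N -> valid j ->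
  killed (descent k *: (e j *: m)).
Proof.
move=> kn; case: (ltngtP j k.+1) => [jk|jk|->] jn;
  last by apply: killed_descent_eS; lia.
- have [jltk|] := ltnP j k.
    rewrite scalerA descent_e_shift //; last by lia.
    by rewrite -scalerA; apply: killed_e; lia.
  move=> kj; have {jk kj} -> : k = j by lia.
  case: j jn => [|j] // jn.
  rewrite scalerA descentS -mulrA (kauffman_ge K) // mulrA.
  rewrite -pzin_alg_central -mulrA -scalerA; apply: killed_scalar.
  by rewrite -scalerA; apply: killed_descent_eS; lia.
- rewrite scalerA -descent_e_far; last by lia.
  by rewrite -scalerA; exact: killed_e.
Qed.

Definition stably_killed (m : M) : Prop :=
  forall k, (k < n)%N -> killed (descent k *: m).

Lemma stably_killed0 : stably_killed 0.
Proof. by move=> k _; rewrite /killed !scaler0. Qed.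

Lemma stably_killedD m m' :
  stably_killed m -> stably_killed m' -> stably_killed (m + m').
Proof.
by move=> Sm Sm' k kn; rewrite scalerDr; apply: killedD; [exact: Sm|exact: Sm'].
Qed.

Lemma stably_killedB m m' :
  stably_killed m -> stably_killed m' -> stably_killed (m - m').
Proof.
by move=> Sm Sm' k kn; rewrite scalerBr; apply: killedB; [exact: Sm|exact: Sm'].
Qed.

Lemma stably_killed_scalar b m :
  stably_killed m -> stably_killed ((pzin_alg b : A) *: m).
Proof.
move=> Sm k kn; rewrite scalerA -pzin_alg_central -scalerA.
by apply: killed_scalar; exact: Sm.
Qed.

Lemma stably_killed_e j m : valid j -> stably_killed (e j *: m).
Proof. by move=> jn k kn; exact: killed_descent_e. Qed.

(** [descent k * g_j] is [g_(j+1) * descent k] for [j < k], a longer descent for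
    [j = k + 1] and [g_j * descent k] for [j > k + 1].  For [j = k] the square
    [g_k^2] is expanded by the skein relation. *)
Lemma stably_killed_g j m :
  valid j -> stably_killed m -> stably_killed (g j *: m).
Proof.
move=> jn Sm k kn; case: (ltngtP j k.+1) => [jk|jk|jk].
- have [jltk|] := ltnP j k.
    rewrite scalerA descent_g_shift //; last by lia.
    by rewrite -scalerA; apply: killed_comm; [apply: x_g; lia | exact: Sm].
  move=> kj; have {jk kj} jk : k = j by lia.
  subst k; case: j jn kn => [|j] // jn kn.
  (* [g^2 = 1 + z (g - e g)], from [g = g^-1 + z (1 - e)]. *)
  have -> : descent j.+1 *: (g j.+1 *: m) = descent j *: m +
      ((pzin_alg z : A) *: (descent j.+1 *: m) -
       (pzin_alg z : A) *: (descent j *: (e j.+1 *: (g j.+1 *: m)))).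
    rewrite descentS -!scalerA [g j.+1 *: (g j.+1 *: m)]scalerA.
    rewrite {1}kauffman_gE // mulrDl (kauffman_gVg K) //.
    rewrite !scalerDl scale1r scalerDr.
    congr (_ + _); rewrite -scalerBr -scalerBr -!scalerA scalerA.
    rewrite -pzin_alg_central -scalerA scalerBl scale1r.
    by [].
  apply: killedD; first by apply: Sm; lia.
  apply: killedB; apply: killed_scalar; first exact: Sm.
  by apply: killed_descent_e => //; lia.
- rewrite scalerA -descent_g_far; last by lia.
  by rewrite -scalerA; apply: killed_comm; [apply: x_g; lia | exact: Sm].
- by rewrite jk scalerA -descentS; apply: Sm; lia.
Qed.

Lemma stably_killed_gV j m :
  valid j -> stably_killed m -> stably_killed (gV j *: m).
Proof.
move=> jn Sm; rewrite kauffman_gVE // scalerBl; apply: stably_killedB.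
  exact: stably_killed_g.
rewrite -scalerA; apply: stably_killed_scalar.
rewrite scalerBl scale1r; apply: stably_killedB => //.
exact: stably_killed_e.
Qed.

Lemma killed_stably m : (0 < n)%N -> stably_killed m -> killed m.
Proof. by move=> n0 /(_ 0 n0); rewrite descent0 scale1r. Qed.

(** An operator that commutes with [g_2, ..., g_(n-1)] passes every letter of a
    descent but the first, so that only [k = 1] needs a computation. *)
Lemma stably_killed_comm w :
  (1 < n)%N -> GRing.comm x w ->
  (forall i, (1 < i < n)%N -> GRing.comm w (g i)) ->
  (forall m, stably_killed m -> killed (g 1%N *: (w *: m))) ->
  forall m, stably_killed m -> stably_killed (w *: m).
Proof.
move=> n1 xw wg base m Sm k; elim: k m Sm => [|k IHk] m Sm kn.
  rewrite descent0 scale1r; apply: killed_comm => //.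
  by apply: killed_stably => //; lia.
case: k IHk kn => [|k] IHk kn.
  by rewrite descentS descent0 mul1r; exact: base.
rewrite descentS -scalerA [g _ *: (w *: m)]scalerA -wg; last by lia.
rewrite -scalerA; apply: IHk; last by lia.
by apply: stably_killed_g => //; lia.
Qed.

Section AffineGenerator.
Variables (y yV : A).
Hypotheses (n1 : (1 < n)%N) (ggV : g 1%N * gV 1%N = 1).
Hypotheses (yyV : y * yV = 1) (yVy : yV * y = 1).
Hypothesis y_g : forall j, (1 < j < n)%N -> GRing.comm y (g j).
Hypothesis y_gyg : GRing.comm y (g 1%N * y * g 1%N).
Hypothesis x_y : forall a, GRing.comm y a -> GRing.comm x a.

(** [g_1 y = (g_1 y g_1) g_1^-1], and [g_1 y g_1] is the second Jucys-Murphy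
    element [y_2], which commutes with [y] and so with [x]. *)
Lemma stably_killed_affine_y m : stably_killed m -> stably_killed (y *: m).
Proof.
apply: stably_killed_comm => // [|{}m Sm]; first exact: x_y.
have -> : g 1%N *: (y *: m) = (g 1%N * y * g 1%N) *: (gV 1%N *: m).
  by rewrite !scalerA -mulrA ggV mulr1.
apply: killed_comm; first exact: x_y.
by apply: killed_stably; [lia | exact: stably_killed_gV].
Qed.

(** [g_1 y^-1 = (g_1^-1 y^-1 g_1^-1) g_1 + z (1 - e_1) y^-1], whose first factor
    is the inverse of [y_2]. *)
Lemma stably_killed_affine_yV m : stably_killed m -> stably_killed (yV *: m).
Proof.
have gVg : gV 1%N * g 1%N = 1 by apply: (kauffman_gVg K).
have x_yV : GRing.comm x yV by apply: (comm_inverse yyV yVy); exact: x_y.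
apply: stably_killed_comm => // [i i_n|{}m Sm].
  by apply/esym; apply: (comm_inverse yyV yVy); apply/esym; exact: y_g.
have x_gyV : GRing.comm x (gV 1%N * yV * gV 1%N).
  apply: (@comm_inverse _ _ (g 1%N * y * g 1%N)); last exact: x_y.
    by rewrite !mulrA -[_ * g 1%N * gV 1%N]mulrA ggV mulr1
      -[_ * y * yV]mulrA yyV mulr1.
  by rewrite !mulrA -[_ * gV 1%N * g 1%N]mulrA gVg mulr1
    -[_ * yV * y]mulrA yVy mulr1.
have yVm : killed (yV *: m).
  by apply: killed_comm => //; apply: killed_stably => //; lia.
have -> : g 1%N *: (yV *: m) = (gV 1%N * yV * gV 1%N) *: (g 1%N *: m) +
    (pzin_alg z : A) *: (yV *: m - e 1%N *: (yV *: m)).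
  rewrite {1}kauffman_gE // scalerDl; congr (_ + _).
    by rewrite !scalerA -[in RHS]mulrA gVg mulr1.
  by rewrite -scalerA scalerBl scale1r.
apply: killedD.
  apply: killed_comm => //; apply: killed_stably; first by lia.
  exact: stably_killed_g.
by apply: killed_scalar; apply: killedB => //; exact: killed_e.
Qed.

End AffineGenerator.

Section DegenerateGenerators.
Variable y : nat -> A.
Local Notation validY j := (0 < j <= n)%N.
Hypothesis x_y : forall j, validY j -> GRing.comm x (y j).
Hypothesis g_yC : forall i j,
  valid i -> validY j -> j != i -> j != i.+1 -> g i * y j = y j * g i.
Hypothesis g_y : forall i, valid i -> g i * y i - y i.+1 * g i = e i - 1.
Hypothesis y_g : forall i, valid i -> y i * g i - g i * y i.+1 = e i - 1.

(** Moving [y_j] through one letter [g_i] changes its index and leaves the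
    error [e_i - 1], where [e_i] is handled by [killed_descent_e] and [1] by a
    shorter descent. *)
Lemma stably_killed_degenerate_y j m :
  validY j -> stably_killed m -> stably_killed (y j *: m).
Proof.
move=> jn Sm k; elim: k j jn m Sm => [|k IHk] j jn m Sm kn.
  rewrite descent0 scale1r; apply: killed_comm; first exact: x_y.
  by apply: killed_stably => //; lia.
have kn1 : valid k.+1 by lia.
have Sgm : stably_killed (g k.+1 *: m) by exact: stably_killed_g.
have Dem : killed (descent k *: (e k.+1 *: m)).
  by apply: killed_descent_e => //; lia.
have Dm : killed (descent k *: m) by apply: Sm; lia.
rewrite descentS -scalerA.
case: (altP (j =P k.+1)) => [->|jk].
  have -> : g k.+1 *: (y k.+1 *: m) =
      y k.+2 *: (g k.+1 *: m) + (e k.+1 *: m - m).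
    rewrite -{4}[m]scale1r -scalerBl -g_y // scalerBl !scalerA.
    by rewrite addrC subrK.
  rewrite scalerDr scalerBr; apply: killedD; last exact: killedB.
  by apply: IHk => //; lia.
case: (altP (j =P k.+2)) => [->|jSk].
  have -> : g k.+1 *: (y k.+2 *: m) =
      y k.+1 *: (g k.+1 *: m) - (e k.+1 *: m - m).
    rewrite -{4}[m]scale1r -scalerBl -y_g // scalerBl !scalerA.
    by rewrite subKr.
  rewrite scalerBr [_ *: (_ - m)]scalerBr; apply: killedB; last exact: killedB.
  by apply: IHk => //; lia.
rewrite [g _ *: _]scalerA g_yC // -scalerA.
by apply: IHk => //; lia.
Qed.

End DegenerateGenerators.

End Stable.
End Kauffman.

(** * Both families satisfy the common relations *)

Section AffineKilling.
Variables (F : comUnitRingType) (n : nat) (rho q : F) (Omega : nat -> F).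
Hypothesis n_ge2 : (2 <= n)%N.
Variables (B : pzAlgType F) (phi : {rmorphism free_alg F (agen n) -> B}).
Hypotheses (phiC : forall c, phi (pzin_alg c) = pzin_alg c).
Hypothesis phi_rel :
  forall a b, @aff_rel F n rho q Omega a b -> phi a = phi b.

Let g i : B := phi (afg F n i).
Let gV i : B := phi (afgV F n i).
Let e i : B := phi (afe F n i).
Let y : B := phi (afy F n).
Let yV : B := phi (afyV F n).

Let phiM a b : phi (a * b) = phi a * phi b. Proof. exact: rmorphM. Qed.
Let phiB a b : phi (a - b) = phi a - phi b. Proof. exact: rmorphB. Qed.
Let phi1 : phi 1 = 1. Proof. exact: rmorph1. Qed.

Lemma aff_kauffman :
  kauffman_relations n (q - q^-1) rho^-1 g gV e.
Proof.
have nextS i : (i.+1 == i.+1) || (i == i.+2) by rewrite eqxx.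
have prevS i : (i == i.+2) || (i.+1 == i.+1) by rewrite eqxx orbT.
split=> [i i_n|i i_n|i i_n|i j i_n j_n ij|i j i_n j_n ij
        |i i_n Si_n|i i_n Si_n|i i_n Si_n|i i_n Si_n|i i_n Si_n].
- by rewrite -phiM -phi1; exact/phi_rel/Aff_gVg.
- by rewrite -phiC -phi1 -!phiB -phiM; exact/phi_rel/Aff_skein.
- by rewrite -phiC -!phiM; exact/phi_rel/Aff_ge.
- by rewrite -!phiM; exact/phi_rel/Aff_ggC.
- by rewrite -!phiM; exact/phi_rel/Aff_geC.
- by rewrite -!phiM; exact/phi_rel/Aff_braid.
- by rewrite -!phiM; apply/phi_rel/Aff_gge.
- by rewrite -!phiM; apply/phi_rel/Aff_gge.
- by rewrite -!phiM; apply/phi_rel/Aff_egg.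
- by rewrite -!phiM; apply/phi_rel/Aff_eee.
Qed.

(** The stably killed vectors form a submodule that contains [e_1 M <> 0]. *)
Lemma aff_killing_extends (M : lmodType B) (x : B) :
  (forall b, exists a, b = phi a) ->
  (forall a, GRing.comm y a -> GRing.comm x a) ->
  simple_module M -> annihilates (x * e 1) M -> ~ annihilates (e 1) M ->
  annihilates x M.
Proof.
move=> phi_surj x_y simpleM xe1 e1M.
have K := aff_kauffman.
have n1 : (0 < 1 < n)%N by rewrite n_ge2.
have y_g j : (1 < j < n)%N -> GRing.comm y (g j).
  move=> /andP[j1 jn]; rewrite /GRing.comm -!phiM.
  by apply/phi_rel/Aff_ygC => //; rewrite jn ltnW.
have x_g j : (1 < j < n)%N -> GRing.comm x (g j).
  by move=> jn; apply: x_y; exact: y_g.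
have x_e j : (1 < j < n)%N -> GRing.comm x (e j).
  move=> /andP[j1 jn]; apply: x_y; rewrite /GRing.comm -!phiM.
  by apply/phi_rel/Aff_yeC => //; rewrite jn ltnW.
have yyV : y * yV = 1 by rewrite -phiM -phi1; exact/phi_rel/Aff_yyV.
have yVy : yV * y = 1 by rewrite -phiM -phi1; exact/phi_rel/Aff_yVy.
have ggV : g 1%N * gV 1%N = 1 by rewrite -phiM -phi1; exact/phi_rel/Aff_ggV.
have y_gyg : GRing.comm y (g 1%N * y * g 1%N).
  by rewrite /GRing.comm !mulrA -!phiM; exact/phi_rel/Aff_ygyg.
have Sy := stably_killed_affine_y K x_g x_e xe1 n_ge2 ggV y_g y_gyg x_y.
have SyV :=
  stably_killed_affine_yV K x_g x_e xe1 n_ge2 ggV yyV yVy y_g y_gyg x_y.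
have Se j m := @stably_killed_e _ _ _ _ _ _ _ _ K _ _ x_g x_e xe1 j m.
have SM : forall m : M, stably_killed n g x m.
  apply: (simple_module_ind phiC phi_surj simpleM).
  - exact: stably_killed0.
  - exact: stably_killedD.
  - exact: stably_killed_scalar.
  - case=> [||i|i|i] m Sm; [exact: Sy | exact: SyV | | |].
    + have -> : free_gen F (AgenG i) = afg F n (val i) by rewrite /afg valK.
      exact: (stably_killed_g K x_g x_e xe1 (valP i)).
    + have -> : free_gen F (AgenGV i) = afgV F n (val i) by rewrite /afgV valK.
      exact: (stably_killed_gV K x_g x_e xe1 (valP i)).
    + have -> : free_gen F (AgenE i) = afe F n (val i) by rewrite /afe valK.
      exact: Se (valP i).
  - apply: contra_notP e1M => no_m m.
    apply/eqP; apply: contra_notT no_m => e1m.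
    by exists (e 1%N *: m) => //; exact: Se.
by move=> m; apply: (killed_stably _ (SM m)); exact: ltnW.
Qed.

End AffineKilling.

Lemma involution_mulLR (A : pzRingType) (s a b : A) :
  s * s = 1 -> s * a = b -> a = s * b.
Proof. by move=> ss <-; rewrite mulrA ss mul1r. Qed.

Lemma involution_mulRL (A : pzRingType) (s a b : A) :
  s * s = 1 -> a * s = b -> a = b * s.
Proof. by move=> ss <-; rewrite -mulrA ss mulr1. Qed.

Section DegenerateKilling.
Variables (F : comNzRingType) (n : nat) (Omega : nat -> F).
Hypothesis n_ge2 : (2 <= n)%N.
Variables (B : pzAlgType F) (phi : {rmorphism free_alg F (dgen n) -> B}).
Hypotheses (phiC : forall c, phi (pzin_alg c) = pzin_alg c).
Hypothesis phi_rel :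
  forall a b, @daff_rel F n Omega a b -> phi a = phi b.

Let s i : B := phi (daf_s F n i).
Let e i : B := phi (daf_e F n i).
Let y i : B := phi (daf_y F n i).

Let phiM a b : phi (a * b) = phi a * phi b. Proof. exact: rmorphM. Qed.
Let phiB a b : phi (a - b) = phi a - phi b. Proof. exact: rmorphB. Qed.
Let phi1 : phi 1 = 1. Proof. exact: rmorph1. Qed.

(** [s_i s_(i+1) e_i = e_(i+1) e_i] is the relation
    [s_i e_(i+1) e_i = s_(i+1) e_i] with the involution [s_i] moved to the other
    side, and likewise for its two companions. *)
Lemma daff_kauffman : kauffman_relations n 0 1 s s e.
Proof.
have invol i : (0 < i < n)%N -> s i * s i = 1.
  by move=> i_n; rewrite -phiM -phi1; exact/phi_rel/Daff_ss.
split=> [i i_n|i i_n|i i_n|i j i_n j_n ij|i j i_n j_n ij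
        |i i_n Si_n|i i_n Si_n|i i_n Si_n|i i_n Si_n|i i_n Si_n].
- exact: invol.
- by rewrite subrr rmorph0 mul0r.
- by rewrite rmorph1 mul1r -phiM; exact/phi_rel/Daff_se.
- by rewrite -!phiM; exact/phi_rel/Daff_ssC.
- by rewrite -!phiM; exact/phi_rel/Daff_seC.
- by rewrite -!phiM; exact/phi_rel/Daff_braid.
- rewrite -mulrA; apply/esym; apply: involution_mulLR (invol _ i_n) _.
  by rewrite mulrA -!phiM; exact/phi_rel/Daff_seSe.
- rewrite -mulrA; apply/esym; apply: involution_mulLR (invol _ Si_n) _.
  by rewrite mulrA -!phiM; exact/phi_rel/Daff_sSeeS.
- apply/esym; apply: involution_mulRL (invol _ Si_n) _.
  by rewrite -!phiM; exact/phi_rel/Daff_eSesS.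
- by rewrite -!phiM; exact/phi_rel/Daff_eSeeS.
Qed.

Lemma daff_killing_extends (M : lmodType B) (x : B) :
  (forall b, exists a, b = phi a) ->
  (forall a, GRing.comm (y 1) a -> GRing.comm x a) ->
  simple_module M -> annihilates (x * e 1) M -> ~ annihilates (e 1) M ->
  annihilates x M.
Proof.
move=> phi_surj x_y1 simpleM xe1 e1M.
have K := daff_kauffman.
have validY1 : (0 < 1 <= n)%N by exact: ltnW n_ge2.
have far1 j : (1 < j)%N -> (1%N != j) && (1%N != j.+1) by case: j => [|[|j]].
have x_g j : (1 < j < n)%N -> GRing.comm x (s j).
  move=> /andP[j1 jn]; apply: x_y1; rewrite /GRing.comm -!phiM; apply/esym.
  have /andP[? ?] := far1 _ j1.
  by apply/phi_rel/Daff_syC => //; rewrite jn ltnW.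
have x_e j : (1 < j < n)%N -> GRing.comm x (e j).
  move=> /andP[j1 jn]; apply: x_y1; rewrite /GRing.comm -!phiM; apply/esym.
  have /andP[? ?] := far1 _ j1.
  by apply/phi_rel/Daff_eyC => //; rewrite jn ltnW.
have x_y j : (0 < j <= n)%N -> GRing.comm x (y j).
  move=> jn; apply: x_y1; rewrite /GRing.comm -!phiM.
  exact/phi_rel/Daff_yyC.
have g_yC i j : (0 < i < n)%N -> (0 < j <= n)%N -> j != i -> j != i.+1 ->
    s i * y j = y j * s i.
  by move=> *; rewrite -!phiM; exact/phi_rel/Daff_syC.
have g_y i : (0 < i < n)%N -> s i * y i - y i.+1 * s i = e i - 1.
  by move=> i_n; rewrite -!phiM -phi1 -!phiB; exact/phi_rel/Daff_sy.
have y_g i : (0 < i < n)%N -> y i * s i - s i * y i.+1 = e i - 1.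
  by move=> i_n; rewrite -!phiM -phi1 -!phiB; exact/phi_rel/Daff_ys.
have Sy j m :=
  @stably_killed_degenerate_y _ _ _ _ _ _ _ _ K M x x_g x_e xe1
    y x_y g_yC g_y y_g j m.
have Se j m := @stably_killed_e _ _ _ _ _ _ _ _ K _ _ x_g x_e xe1 j m.
have SM : forall m : M, stably_killed n s x m.
  apply: (simple_module_ind phiC phi_surj simpleM).
  - exact: stably_killed0.
  - exact: stably_killedD.
  - exact: stably_killed_scalar.
  - case=> i m Sm.
    + have -> : free_gen F (DgenS i) = daf_s F n (val i) by rewrite /daf_s valK.
      exact: (stably_killed_g K x_g x_e xe1 (valP i)).
    + have -> : free_gen F (DgenE i) = daf_e F n (val i) by rewrite /daf_e valK.
      exact: Se (valP i).
    + have -> : free_gen F (DgenY i) = daf_y F n (val i) by rewrite /daf_y valK.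
      exact: Sy (valP i) Sm.
  - apply: contra_notP e1M => no_m m.
    apply/eqP; apply: contra_notT no_m => e1m.
    by exists (e 1%N *: m) => //; exact: Se.
by move=> m; apply: (killed_stably _ (SM m)); exact: ltnW.
Qed.

End DegenerateKilling.

(** * From two strands to [n] strands

    The algebra on [m] strands maps to the algebra on [n >= m] strands.  To
    compare the two presentations, call [a] and [b] in agreement when they
    have the same image in [B].  Agreement is compatible with the ring
    operations, so it holds for the two sides of every relation as soon as it
    holds for the generators. *)

Section MorphismAgreement.
Variables (A A' B : pzRingType).
Variables (phi : {rmorphism A -> B}) (chi : {rmorphism A' -> B}).

Local Notation "a ~ b" := (chi a = phi b) (at level 70).

Lemma agreeM a b a' b' : a ~ a' -> b ~ b' -> a * b ~ a' * b'.
Proof. by rewrite !rmorphM => -> ->. Qed.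

Lemma agreeD a b a' b' : a ~ a' -> b ~ b' -> a + b ~ a' + b'.
Proof. by rewrite !rmorphD => -> ->. Qed.

Lemma agreeB a b a' b' : a ~ a' -> b ~ b' -> a - b ~ a' - b'.
Proof. by rewrite !rmorphB => -> ->. Qed.

Lemma agreeX k a a' : a ~ a' -> a ^+ k ~ a' ^+ k.
Proof. by rewrite !rmorphXn => ->. Qed.

Lemma agree1 : 1 ~ 1.
Proof. by rewrite !rmorph1. Qed.

Lemma agree0 : 0 ~ 0.
Proof. by rewrite !rmorph0. Qed.

End MorphismAgreement.

Lemma widen_valid (m n k : nat) :
  (m <= n)%N -> (0 < k < m)%N -> (0 < k < n)%N.
Proof. by move=> mn /andP[-> km]; exact: leq_trans km mn. Qed.

Definition widen_idx (m n : nat) (mn : (m <= n)%N) (i : idx m) : idx n :=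
  exist _ (val i) (widen_valid mn (valP i)).

Lemma insub_widen_idx (m n : nat) (mn : (m <= n)%N) (k : nat)
    (k_m : (0 < k < m)%N) :
  insub k = Some (widen_idx mn (Sub k k_m)).
Proof. exact: valK (widen_idx mn (Sub k k_m)). Qed.

Section Widen.
Variables (m n : nat) (mn : (m <= n)%N).

Definition widen_agen (x : agen m) : agen n :=
  match x with
  | AgenY => AgenY n
  | AgenYV => AgenYV n
  | AgenG i => AgenG (widen_idx mn i)
  | AgenGV i => AgenGV (widen_idx mn i)
  | AgenE i => AgenE (widen_idx mn i)
  end.

Definition widen_dgen (x : dgen m) : dgen n :=
  match x with
  | DgenS i => DgenS (widen_idx mn i)
  | DgenE i => DgenE (widen_idx mn i)
  | DgenY j => DgenY (@widen_idx m.+1 n.+1 mn j)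
  end.

Section Affine.
Variables (F : comUnitRingType).
Local Notation psi := (@relabel F (agen m) (agen n) widen_agen).

Lemma widen_afy : psi (afy F m) = afy F n.
Proof. exact: relabel_gen. Qed.

Lemma widen_afyV : psi (afyV F m) = afyV F n.
Proof. exact: relabel_gen. Qed.

Lemma widen_afg i : (0 < i < m)%N -> psi (afg F m i) = afg F n i.
Proof.
move=> i_m; rewrite /afg (insubT (fun i => (0 < i < m)%N) i_m).
by rewrite (insub_widen_idx mn i_m); exact: relabel_gen.
Qed.

Lemma widen_afgV i : (0 < i < m)%N -> psi (afgV F m i) = afgV F n i.
Proof.
move=> i_m; rewrite /afgV (insubT (fun i => (0 < i < m)%N) i_m).
by rewrite (insub_widen_idx mn i_m); exact: relabel_gen.
Qed.

Lemma widen_afe i : (0 < i < m)%N -> psi (afe F m i) = afe F n i.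
Proof.
move=> i_m; rewrite /afe (insubT (fun i => (0 < i < m)%N) i_m).
by rewrite (insub_widen_idx mn i_m); exact: relabel_gen.
Qed.

End Affine.

Section AffineTransfer.
Variables (F : comUnitRingType) (rho q : F) (Omega : nat -> F).
Variables (B : pzAlgType F) (phi : {rmorphism free_alg F (agen n) -> B})
  (chi : {rmorphism free_alg F (agen m) -> B}).
Hypothesis phiC : forall c, phi (pzin_alg c) = pzin_alg c.
Hypothesis chiC : forall c, chi (pzin_alg c) = pzin_alg c.
Hypothesis phi_rel : forall a b, aff_rel rho q Omega a b -> phi a = phi b.
Hypothesis chi_y : chi (afy F m) = phi (afy F n).
Hypothesis chi_yV : chi (afyV F m) = phi (afyV F n).
Hypothesis chi_g :
  forall i, (0 < i < m)%N -> chi (afg F m i) = phi (afg F n i).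
Hypothesis chi_gV :
  forall i, (0 < i < m)%N -> chi (afgV F m i) = phi (afgV F n i).
Hypothesis chi_e :
  forall i, (0 < i < m)%N -> chi (afe F m i) = phi (afe F n i).

Local Notation "a ~ b" := (chi a = phi b) (at level 70).

Let tM := @agreeM _ _ _ phi chi.
Let tB := @agreeB _ _ _ phi chi.
Let tX := @agreeX _ _ _ phi chi.
Let t1 := @agree1 _ _ _ phi chi.

Lemma aff_rel_transfer a b : aff_rel rho q Omega a b -> chi a = chi b.
Proof.
have valid k : (0 < k < m)%N -> (0 < k < n)%N by exact: widen_valid.
have gt1 : (1 < m)%N -> (1 < n)%N by move=> m1; exact: leq_trans m1 mn.
have tC c : pzin_alg c ~ pzin_alg c by rewrite chiC phiC.
have ty := chi_y; have tyV := chi_yV.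
have tg := chi_g; have tgV := chi_gV; have te := chi_e.
have rel a' b' a0 b0 : aff_rel rho q Omega a' b' -> a0 ~ a' -> b0 ~ b' ->
    chi a0 = chi b0.
  by move=> /phi_rel ab -> ->.
case=> [i i_m|i i_m| | |i i_m Si_m|i j i_m j_m ij|m1|j j_m j2|i i_m|k m1 k0
  |i j i_m j_m ij|i j i_m j_m ij|j j_m j2|i i_m|i i_m|i j i_m j_m ij
  |i j i_m j_m ij|i j i_m j_m ij|i j i_m j_m ij|i i_m|m1|m1].
- exact: rel (Aff_ggV _ _ _ (valid _ i_m)) (tM (tg _ i_m) (tgV _ i_m)) t1.
- exact: rel (Aff_gVg _ _ _ (valid _ i_m)) (tM (tgV _ i_m) (tg _ i_m)) t1.
- exact: rel (Aff_yyV _ _ _ _) (tM ty tyV) t1.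
- exact: rel (Aff_yVy _ _ _ _) (tM tyV ty) t1.
- exact: rel (Aff_braid _ _ _ (valid _ i_m) (valid _ Si_m))
    (tM (tM (tg _ i_m) (tg _ Si_m)) (tg _ i_m))
    (tM (tM (tg _ Si_m) (tg _ i_m)) (tg _ Si_m)).
- exact: rel (Aff_ggC _ _ _ (valid _ i_m) (valid _ j_m) ij)
    (tM (tg _ i_m) (tg _ j_m)) (tM (tg _ j_m) (tg _ i_m)).
- exact: rel (Aff_ygyg _ _ _ (gt1 m1))
    (tM (tM (tM ty (tg 1%N m1)) ty) (tg 1%N m1))
    (tM (tM (tM (tg 1%N m1) ty) (tg 1%N m1)) ty).
- exact: rel (Aff_ygC _ _ _ (valid _ j_m) j2)
    (tM ty (tg _ j_m)) (tM (tg _ j_m) ty).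
- exact: rel (Aff_ee _ _ _ (valid _ i_m))
    (tM (te _ i_m) (te _ i_m)) (tM (tC _) (te _ i_m)).
- exact: rel (Aff_eye _ _ _ (gt1 m1) k0)
    (tM (tM (te 1%N m1) (tX k ty)) (te 1%N m1)) (tM (tC _) (te 1%N m1)).
- exact: rel (Aff_geC _ _ _ (valid _ i_m) (valid _ j_m) ij)
    (tM (tg _ i_m) (te _ j_m)) (tM (te _ j_m) (tg _ i_m)).
- exact: rel (Aff_eeC _ _ _ (valid _ i_m) (valid _ j_m) ij)
    (tM (te _ i_m) (te _ j_m)) (tM (te _ j_m) (te _ i_m)).
- exact: rel (Aff_yeC _ _ _ (valid _ j_m) j2)
    (tM ty (te _ j_m)) (tM (te _ j_m) ty).
- exact: rel (Aff_ge _ _ _ (valid _ i_m))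
    (tM (tg _ i_m) (te _ i_m)) (tM (tC _) (te _ i_m)).
- exact: rel (Aff_eg _ _ _ (valid _ i_m))
    (tM (te _ i_m) (tg _ i_m)) (tM (tC _) (te _ i_m)).
- exact: rel (Aff_ege _ _ _ (valid _ i_m) (valid _ j_m) ij)
    (tM (tM (te _ i_m) (tg _ j_m)) (te _ i_m)) (tM (tC _) (te _ i_m)).
- exact: rel (Aff_eee _ _ _ (valid _ i_m) (valid _ j_m) ij)
    (tM (tM (te _ i_m) (te _ j_m)) (te _ i_m)) (te _ i_m).
- exact: rel (Aff_gge _ _ _ (valid _ i_m) (valid _ j_m) ij)
    (tM (tM (tg _ i_m) (tg _ j_m)) (te _ i_m)) (tM (te _ j_m) (te _ i_m)).
- exact: rel (Aff_egg _ _ _ (valid _ i_m) (valid _ j_m) ij)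
    (tM (tM (te _ i_m) (tg _ j_m)) (tg _ i_m)) (tM (te _ i_m) (te _ j_m)).
- exact: rel (Aff_skein _ _ _ (valid _ i_m))
    (tB (tg _ i_m) (tgV _ i_m)) (tM (tC _) (tB t1 (te _ i_m))).
- exact: rel (Aff_eygyg _ _ _ (gt1 m1))
    (tM (tM (tM (tM (te 1%N m1) ty) (tg 1%N m1)) ty) (tg 1%N m1)) (te 1%N m1).
- exact: rel (Aff_gygye _ _ _ (gt1 m1))
    (tM (tM (tM (tM (tg 1%N m1) ty) (tg 1%N m1)) ty) (te 1%N m1)) (te 1%N m1).
Qed.

End AffineTransfer.

Section DegenerateTransfer.
Variables (F : comNzRingType) (Omega : nat -> F).
Variables (B : pzAlgType F) (phi : {rmorphism free_alg F (dgen n) -> B})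
  (chi : {rmorphism free_alg F (dgen m) -> B}).
Hypothesis phiC : forall c, phi (pzin_alg c) = pzin_alg c.
Hypothesis chiC : forall c, chi (pzin_alg c) = pzin_alg c.
Hypothesis phi_rel : forall a b, daff_rel Omega a b -> phi a = phi b.
Hypothesis chi_s :
  forall i, (0 < i < m)%N -> chi (daf_s F m i) = phi (daf_s F n i).
Hypothesis chi_e :
  forall i, (0 < i < m)%N -> chi (daf_e F m i) = phi (daf_e F n i).
Hypothesis chi_y :
  forall j, (0 < j <= m)%N -> chi (daf_y F m j) = phi (daf_y F n j).

Local Notation "a ~ b" := (chi a = phi b) (at level 70).

Let tM := @agreeM _ _ _ phi chi.
Let tD := @agreeD _ _ _ phi chi.
Let tB := @agreeB _ _ _ phi chi.
Let tX := @agreeX _ _ _ phi chi.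
Let t1 := @agree1 _ _ _ phi chi.
Let t0 := @agree0 _ _ _ phi chi.

Lemma daff_rel_transfer a b : daff_rel Omega a b -> chi a = chi b.
Proof.
have valid k : (0 < k < m)%N -> (0 < k < n)%N by exact: widen_valid.
have validY k : (0 < k <= m)%N -> (0 < k <= n)%N.
  exact: (@widen_valid m.+1 n.+1).
have gt1 : (1 < m)%N -> (1 < n)%N by move=> m1; exact: leq_trans m1 mn.
have tC c : pzin_alg c ~ pzin_alg c by rewrite chiC phiC.
have ts := chi_s; have te := chi_e; have ty := chi_y.
have ylo k : (0 < k < m)%N -> (0 < k <= m)%N by move=> /andP[-> /ltnW].
have yhi k : (0 < k < m)%N -> (0 < k.+1 <= m)%N by move=> /andP[_].
have rel a' b' a0 b0 : daff_rel Omega a' b' -> a0 ~ a' -> b0 ~ b' ->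
    chi a0 = chi b0.
  by move=> /phi_rel ab -> ->.
case=> [i i_m|i j i_m j_m ij|i i_m Si_m|i j i_m j_m ji jSi|i i_m|k m1 k0
  |i j i_m j_m ij|i j i_m j_m ij|i j i_m j_m ji jSi|i j i_m j_m|i i_m|i i_m
  |i i_m Si_m|i i_m Si_m|i i_m Si_m|i i_m Si_m|i i_m Si_m|i i_m Si_m
  |i i_m|i i_m|i i_m|i i_m].
- exact: rel (Daff_ss _ (valid _ i_m)) (tM (ts _ i_m) (ts _ i_m)) t1.
- exact: rel (Daff_ssC _ (valid _ i_m) (valid _ j_m) ij)
    (tM (ts _ i_m) (ts _ j_m)) (tM (ts _ j_m) (ts _ i_m)).
- exact: rel (Daff_braid _ (valid _ i_m) (valid _ Si_m))
    (tM (tM (ts _ i_m) (ts _ Si_m)) (ts _ i_m))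
    (tM (tM (ts _ Si_m) (ts _ i_m)) (ts _ Si_m)).
- exact: rel (Daff_syC _ (valid _ i_m) (validY _ j_m) ji jSi)
    (tM (ts _ i_m) (ty _ j_m)) (tM (ty _ j_m) (ts _ i_m)).
- exact: rel (Daff_ee _ (valid _ i_m))
    (tM (te _ i_m) (te _ i_m)) (tM (tC _) (te _ i_m)).
- exact: rel (Daff_eye _ (gt1 m1) k0)
    (tM (tM (te 1%N m1) (tX k (ty 1%N (ltnW m1)))) (te 1%N m1))
    (tM (tC _) (te 1%N m1)).
- exact: rel (Daff_seC _ (valid _ i_m) (valid _ j_m) ij)
    (tM (ts _ i_m) (te _ j_m)) (tM (te _ j_m) (ts _ i_m)).
- exact: rel (Daff_eeC _ (valid _ i_m) (valid _ j_m) ij)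
    (tM (te _ i_m) (te _ j_m)) (tM (te _ j_m) (te _ i_m)).
- exact: rel (Daff_eyC _ (valid _ i_m) (validY _ j_m) ji jSi)
    (tM (te _ i_m) (ty _ j_m)) (tM (ty _ j_m) (te _ i_m)).
- exact: rel (Daff_yyC _ (validY _ i_m) (validY _ j_m))
    (tM (ty _ i_m) (ty _ j_m)) (tM (ty _ j_m) (ty _ i_m)).
- exact: rel (Daff_es _ (valid _ i_m)) (tM (te _ i_m) (ts _ i_m)) (te _ i_m).
- exact: rel (Daff_se _ (valid _ i_m)) (tM (ts _ i_m) (te _ i_m)) (te _ i_m).
- exact: rel (Daff_seSe _ (valid _ i_m) (valid _ Si_m))
    (tM (tM (ts _ i_m) (te _ Si_m)) (te _ i_m)) (tM (ts _ Si_m) (te _ i_m)).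
- exact: rel (Daff_eeSs _ (valid _ i_m) (valid _ Si_m))
    (tM (tM (te _ i_m) (te _ Si_m)) (ts _ i_m)) (tM (te _ i_m) (ts _ Si_m)).
- exact: rel (Daff_eSesS _ (valid _ i_m) (valid _ Si_m))
    (tM (tM (te _ Si_m) (te _ i_m)) (ts _ Si_m)) (tM (te _ Si_m) (ts _ i_m)).
- exact: rel (Daff_sSeeS _ (valid _ i_m) (valid _ Si_m))
    (tM (tM (ts _ Si_m) (te _ i_m)) (te _ Si_m)) (tM (ts _ i_m) (te _ Si_m)).
- exact: rel (Daff_eSeeS _ (valid _ i_m) (valid _ Si_m))
    (tM (tM (te _ Si_m) (te _ i_m)) (te _ Si_m)) (te _ Si_m).
- exact: rel (Daff_eeSe _ (valid _ i_m) (valid _ Si_m))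
    (tM (tM (te _ i_m) (te _ Si_m)) (te _ i_m)) (te _ i_m).
- exact: rel (Daff_sy _ (valid _ i_m))
    (tB (tM (ts _ i_m) (ty _ (ylo _ i_m))) (tM (ty _ (yhi _ i_m)) (ts _ i_m)))
    (tB (te _ i_m) t1).
- exact: rel (Daff_ys _ (valid _ i_m))
    (tB (tM (ty _ (ylo _ i_m)) (ts _ i_m)) (tM (ts _ i_m) (ty _ (yhi _ i_m))))
    (tB (te _ i_m) t1).
- exact: rel (Daff_eyy _ (valid _ i_m))
    (tM (te _ i_m) (tD (ty _ (ylo _ i_m)) (ty _ (yhi _ i_m)))) t0.
- exact: rel (Daff_yye _ (valid _ i_m))
    (tM (tD (ty _ (ylo _ i_m)) (ty _ (yhi _ i_m))) (te _ i_m)) t0.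
Qed.

End DegenerateTransfer.

Section Degenerate.
Variables (F : comNzRingType).
Local Notation psi := (@relabel F (dgen m) (dgen n) widen_dgen).

Lemma widen_daf_s i : (0 < i < m)%N -> psi (daf_s F m i) = daf_s F n i.
Proof.
move=> i_m; rewrite /daf_s (insubT (fun i => (0 < i < m)%N) i_m).
by rewrite (insub_widen_idx mn i_m); exact: relabel_gen.
Qed.

Lemma widen_daf_e i : (0 < i < m)%N -> psi (daf_e F m i) = daf_e F n i.
Proof.
move=> i_m; rewrite /daf_e (insubT (fun i => (0 < i < m)%N) i_m).
by rewrite (insub_widen_idx mn i_m); exact: relabel_gen.
Qed.

Lemma widen_daf_y j : (0 < j <= m)%N -> psi (daf_y F m j) = daf_y F n j.
Proof.
move=> j_m; rewrite /daf_y (insubT (fun j => (0 < j < m.+1)%N) j_m).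
by rewrite (@insub_widen_idx m.+1 n.+1 mn _ j_m); exact: relabel_gen.
Qed.

End Degenerate.
End Widen.

(** * Factorization through cyclotomic quotients *)

Lemma pullback_is_module_action (A B : pzRingType) (f : {rmorphism A -> B})
    (M : lmodType B) :
  is_module_action (fun (a : A) (m : M) => f a *: m).
Proof.
split=> [m|a b m|a b m|a m m'].
- by rewrite rmorph1 scale1r.
- by rewrite rmorphM scalerA.
- by rewrite rmorphD scalerDl.
- by rewrite scalerDr.
Qed.

(** Polynomials in [y] lie in its bicommutant; this is the form in which the
    killing lemmas use that [x] is a polynomial in [y]. *)
Lemma prod_sub_bicommutant (F : pzRingType) (A : pzAlgType F) (y : A) (r : nat)
    (u : 'I_r -> F) (a : A) :
  GRing.comm y a -> GRing.comm (\prod_(i < r) (y - pzin_alg (u i))) a.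
Proof.
move=> ya; apply/commr_sym/commr_prod => i _.
by apply: commrB; [exact: commr_sym | apply/esym; exact: pzin_alg_central].
Qed.

Lemma quot_pi_surj (R : pzRingType) (A : pzAlgType R) (rel : A -> A -> Prop) b :
  exists a, b = quot_pi rel a.
Proof. by exists (quot_repr b); rewrite quot_reprK. Qed.

Lemma one_not_annihilates (A : pzRingType) (M : lmodType A) :
  simple_module M -> ~ annihilates (1 : A) M.
Proof. by move=> [[m /eqP m0] _] /(_ m); rewrite scale1r. Qed.

Section AffineModules.
Variables (F : closedFieldType) (n : nat) (rho q : F) (Omega : nat -> F).
Hypothesis n_ge2 : (2 <= n)%N.
Variable M : lmodType (affBMW n rho q Omega).
Hypotheses (simpleM : simple_module M) (fdM : finite_dimensional M).

Local Notation B := (affBMW n rho q Omega).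
Local Notation rel := (@aff_rel F n rho q Omega).
Local Notation e := (aff_e n rho q Omega).
Local Notation y := (aff_y1 n rho q Omega).

Lemma aff_y1_injective (m : M) : y *: m = 0 -> m = 0.
Proof.
move=> ym; have yVy : quot_pi rel (afyV F n) * y = 1.
  exact: etrans (esym (quot_pi_mul _ _ _))
    (quot_pi_rel (Aff_yVy n rho q Omega)).
by rewrite -[m]scale1r -yVy -scalerA ym scaler0.
Qed.

Lemma aff_minimal_factors (a : B) :
  ~ annihilates a M ->
  exists (r : nat) (u : 'I_r -> F),
    [/\ (1 <= r)%N, forall i, u i != 0,
        annihilates (\prod_(i < r) (y - pzin_alg (u i)) * a) M &
        forall c : 'I_r -> F,
          annihilates (\sum_(i < r) pzin_alg (c i) * (y ^+ i * a)) M ->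
          forall i, c i = 0].
Proof.
move=> aM.
have [ev evC evX] :=
  exists_poly_eval (phi := quot_pi rel) (fun c => erefl) (afy F n).
have [r [u [r1 uM u0 indep]]] := exists_minimal_factors evC fdM aM.
rewrite evX in uM u0 indep; exists r, u; split.
- exact: r1.
- by apply: u0 => m; exact: aff_y1_injective.
- exact: uM.
- exact: indep.
Qed.

(** Admissibility is a statement about [n = 2]; restriction along the map from
    two to [n] strands brings it to [M]. *)
Lemma aff_restricted_action :
  exists act : affBMW 2 rho q Omega -> M -> M,
    [/\ is_module_action act,
        forall c m, act (pzin_alg c) m = (pzin_alg c : B) *: m,
        forall m, act (aff_y1 2 rho q Omega) m = y *: m &
        forall m, act (aff_e 2 rho q Omega 1) m = e 1 *: m].
Proof.
pose psi := @relabel F (agen 2) (agen n) (widen_agen n_ge2).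
pose chi := GRing.RMorphism.clone _ _ (quot_pi rel \o psi) _.
have chiE a : chi a = quot_pi rel (psi a) by [].
have chiC c : chi (pzin_alg c) = pzin_alg c by rewrite chiE /psi relabelC.
have chi_rel : forall a b, @aff_rel F 2 rho q Omega a b -> chi a = chi b.
  apply: (aff_rel_transfer n_ge2 (phi := quot_pi rel)) => //.
  - exact: quot_pi_rel.
  - by rewrite chiE /psi widen_afy.
  - by rewrite chiE /psi widen_afyV.
  - by move=> i i2; rewrite chiE /psi widen_afg.
  - by move=> i i2; rewrite chiE /psi widen_afgV.
  - by move=> i i2; rewrite chiE /psi widen_afe.
have [act actP actE] := descend_action (pullback_is_module_action chi M)
  (fun a b ab m => congr1 (fun c => c *: m) (chi_rel a b ab)).
exists act; split=> // [c m|m|m].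
- by rewrite [LHS]actE chiC.
- by rewrite [LHS]actE chiE /psi widen_afy.
- by rewrite [LHS]actE chiE /psi widen_afe.
Qed.

Lemma aff_factors_cyc (r : nat) (u : 'I_r -> F) :
  annihilates (\prod_(i < r) (y - pzin_alg (u i))) M ->
  exists2 act : cycBMW n rho q Omega u -> M -> M, is_module_action act &
    forall a m, act (cyc_pi u a) m = a *: m.
Proof.
move=> uM; apply: descend_action (scale_is_module_action M) _ => a b [] m.
by rewrite uM scale0r.
Qed.

Lemma aff_factors_hecke :
  annihilates (e 1) M ->
  exists (r : nat) (u : 'I_r -> F),
    [/\ (1 <= r)%N, forall i, u i != 0 &
        factors_through (fun a : B => hecke_pi (cyc_pi u a)) M].
Proof.
move=> e1M.
have [r [u [r1 u0 uM _]]] := aff_minimal_factors (one_not_annihilates simpleM).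
rewrite mulr1 in uM.
have [act actP actE] := aff_factors_cyc uM.
have [a b [] m|act' act'P act'E] :=
    descend_action (rel := @hecke_rel F n rho q Omega r u) actP.
  by rewrite actE e1M (module_action0 _ actP).
exists r, u; split=> //; exists act' => // a m.
by rewrite [RHS]act'E actE.
Qed.

Lemma aff_factors_admissible :
  ~ annihilates (e 1) M ->
  exists (r : nat) (u : 'I_r -> F),
    [/\ (1 <= r)%N, forall i, u i != 0,
        factors_through (@cyc_pi F n rho q Omega r u) M &
        admissible rho q Omega u].
Proof.
move=> e1M; have [r [u [r1 u0 ue1M indep]]] := aff_minimal_factors e1M.
have uM : annihilates (\prod_(i < r) (y - pzin_alg (u i))) M.
  apply: (aff_killing_extends n_ge2 (phi := quot_pi rel) _
    (@quot_pi_rel _ _ rel) (@quot_pi_surj _ _ rel) _ simpleM ue1M e1M).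
    by [].
  by move=> a; exact: prod_sub_bicommutant.
exists r, u; split; [exact: r1 | exact: u0 | | ].
  have [act actP actE] := aff_factors_cyc uM.
  by exists act => // a m; rewrite actE.
have [act [actP actC acty acte]] := aff_restricted_action.
apply: (cyclotomic_lin_indep actP actC acty acte) indep => a b [] m.
by rewrite (action_prod_sub u m actP actC acty) uM (module_action0 _ actP).
Qed.

End AffineModules.

Section DegenerateModules.
Variables (F : closedFieldType) (n : nat) (Omega : nat -> F).
Hypothesis n_ge2 : (2 <= n)%N.
Variable M : lmodType (daffBMW n Omega).
Hypotheses (simpleM : simple_module M) (fdM : finite_dimensional M).

Local Notation B := (daffBMW n Omega).
Local Notation rel := (@daff_rel F n Omega).
Local Notation e := (daff_e n Omega).
Local Notation y := (daff_y n Omega 1).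

Lemma daff_minimal_factors (a : B) :
  ~ annihilates a M ->
  exists (r : nat) (u : 'I_r -> F),
    [/\ (1 <= r)%N,
        annihilates (\prod_(i < r) (y - pzin_alg (u i)) * a) M &
        forall c : 'I_r -> F,
          annihilates (\sum_(i < r) pzin_alg (c i) * (y ^+ i * a)) M ->
          forall i, c i = 0].
Proof.
move=> aM.
have [ev evC evX] :=
  exists_poly_eval (phi := quot_pi rel) (fun c => erefl) (daf_y F n 1).
have [r [u [r1 uM _ indep]]] := exists_minimal_factors evC fdM aM.
rewrite evX in uM indep; exists r, u; split.
- exact: r1.
- exact: uM.
- exact: indep.
Qed.

Lemma daff_restricted_action :
  exists act : daffBMW 2 Omega -> M -> M,
    [/\ is_module_action act,
        forall c m, act (pzin_alg c) m = (pzin_alg c : B) *: m,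
        forall m, act (daff_y 2 Omega 1) m = y *: m &
        forall m, act (daff_e 2 Omega 1) m = e 1 *: m].
Proof.
pose psi := @relabel F (dgen 2) (dgen n) (widen_dgen n_ge2).
pose chi := GRing.RMorphism.clone _ _ (quot_pi rel \o psi) _.
have chiE a : chi a = quot_pi rel (psi a) by [].
have chiC c : chi (pzin_alg c) = pzin_alg c by rewrite chiE /psi relabelC.
have chi_rel : forall a b, @daff_rel F 2 Omega a b -> chi a = chi b.
  apply: (daff_rel_transfer n_ge2 (phi := quot_pi rel)) => //.
  - exact: quot_pi_rel.
  - by move=> i i2; rewrite chiE /psi widen_daf_s.
  - by move=> i i2; rewrite chiE /psi widen_daf_e.
  - by move=> j j2; rewrite chiE /psi widen_daf_y.
have [act actP actE] := descend_action (pullback_is_module_action chi M)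
  (fun a b ab m => congr1 (fun c => c *: m) (chi_rel a b ab)).
exists act; split=> // [c m|m|m].
- by rewrite [LHS]actE chiC.
- by rewrite [LHS]actE chiE /psi widen_daf_y.
- by rewrite [LHS]actE chiE /psi widen_daf_e.
Qed.

Lemma daff_factors_dcyc (r : nat) (u : 'I_r -> F) :
  annihilates (\prod_(i < r) (y - pzin_alg (u i))) M ->
  exists2 act : dcycBMW n Omega u -> M -> M, is_module_action act &
    forall a m, act (dcyc_pi u a) m = a *: m.
Proof.
move=> uM; apply: descend_action (scale_is_module_action M) _ => a b [] m.
by rewrite uM scale0r.
Qed.

Lemma daff_factors_dhecke :
  annihilates (e 1) M ->
  exists (r : nat) (u : 'I_r -> F),
    [/\ (1 <= r)%N &
        factors_through (fun a : B => dhecke_pi (dcyc_pi u a)) M].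
Proof.
move=> e1M.
have [r [u [r1 uM _]]] := daff_minimal_factors (one_not_annihilates simpleM).
rewrite mulr1 in uM.
have [act actP actE] := daff_factors_dcyc uM.
have [a b [] m|act' act'P act'E] :=
    descend_action (rel := @dhecke_rel F n Omega r u) actP.
  by rewrite actE e1M (module_action0 _ actP).
exists r, u; split=> //; exists act' => // a m.
by rewrite [RHS]act'E actE.
Qed.

Lemma daff_factors_admissible :
  ~ annihilates (e 1) M ->
  exists (r : nat) (u : 'I_r -> F),
    [/\ (1 <= r)%N,
        factors_through (@dcyc_pi F n Omega r u) M &
        dadmissible Omega u].
Proof.
move=> e1M; have [r [u [r1 ue1M indep]]] := daff_minimal_factors e1M.
have uM : annihilates (\prod_(i < r) (y - pzin_alg (u i))) M.
  apply: (daff_killing_extends n_ge2 (phi := quot_pi rel) _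
    (@quot_pi_rel _ _ rel) (@quot_pi_surj _ _ rel) _ simpleM ue1M e1M).
    by [].
  by move=> a; exact: prod_sub_bicommutant.
exists r, u; split; [exact: r1 | | ].
  have [act actP actE] := daff_factors_dcyc uM.
  by exists act => // a m; rewrite actE.
have [act [actP actC acty acte]] := daff_restricted_action.
apply: (cyclotomic_lin_indep actP actC acty acte) indep => a b [] m.
by rewrite (action_prod_sub u m actP actC acty) uM (module_action0 _ actP).
Qed.

End DegenerateModules.

Theorem corollary6p6 (F : closedFieldType) (n : nat) (n_ge2 : (2 <= n)%N) :
  (forall (rho q : F) (Omega : nat -> F)
     (rho_neq0 : rho != 0) (q_neq0 : q != 0)
     (ground : rho^-1 - rho = (q^-1 - q) * (Omega 0%N - 1))
     (M : lmodType (affBMW n rho q Omega)),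
   simple_module M -> finite_dimensional M ->
     (annihilates (aff_e n rho q Omega 1) M ->
        exists (r : nat) (u : 'I_r -> F),
          [/\ (1 <= r)%N, forall i, u i != 0 &
              factors_through
                (fun a : affBMW n rho q Omega => hecke_pi (cyc_pi u a)) M])
  /\ (~ annihilates (aff_e n rho q Omega 1) M ->
        exists (r : nat) (u : 'I_r -> F),
          [/\ (1 <= r)%N, forall i, u i != 0,
              factors_through (@cyc_pi F n rho q Omega r u) M &
              admissible rho q Omega u]))
  /\
  (forall (Omega : nat -> F) (M : lmodType (daffBMW n Omega)),
   simple_module M -> finite_dimensional M ->
     (annihilates (daff_e n Omega 1) M ->
        exists (r : nat) (u : 'I_r -> F),
          [/\ (1 <= r)%N &
              factors_through
                (fun a : daffBMW n Omega => dhecke_pi (dcyc_pi u a)) M])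
  /\ (~ annihilates (daff_e n Omega 1) M ->
        exists (r : nat) (u : 'I_r -> F),
          [/\ (1 <= r)%N,
              factors_through (@dcyc_pi F n Omega r u) M &
              dadmissible Omega u])).
Proof.
split=> [rho q Omega _ _ _ M simpleM fdM|Omega M simpleM fdM]; split=> e1M.
- exact: aff_factors_hecke.
- exact: aff_factors_admissible.
- exact: daff_factors_dhecke.
- exact: daff_factors_admissible.
Qed.
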